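(* Let $N\ge 1$ be an integer. For all values of the parameters $\Lambda_{\rm b}>0$, $\Lambda_{\rm s}>0$, $p_{\rm T}\in(0,1)$, $p_{\rm Q}\in(0,1)$, $p_{\rm M}\in(0,1)$ with $p_{\rm Q}+p_{\rm M}<1$, the limit order book Markov chain $\{\boldsymbol U(t)\}_{t\in\mathbb Z_+}$ on $\mathbb Z_+^N\times\mathbb Z_+^N$ described in the context is irreducible, aperiodic and positive recurrent. Therefore it has a unique set of equilibrium (stationary) probabilities $\pi=\big(\pi(\boldsymbol b,\boldsymbol s):\ \boldsymbol b,\boldsymbol s\in\mathbb Z_+^N\big)$, and for every initial state $\boldsymbol U(0)$ (deterministic or random) the distribution of $\boldsymbol U(t)$ converges weakly to $\pi$ as $t\to\infty$: $$\lim_{t\to\infty}\mathbb P\big(\boldsymbol U(t)=(\boldsymbol b,\boldsymbol s)\big)=\pi(\boldsymbol b,\boldsymbol s)\qquad\text{for all }\boldsymbol b,\boldsymbol s\in\mathbb Z_+^N.$$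
   Context: Notation: $\mathbb Z_+=\{0,1,2,\dots\}$. The limit order book Markov chain. There are $N$ price levels $c_1<\dots<c_N$. The state at time $t\in\mathbb Z_+$ is $\boldsymbol U(t)=(\boldsymbol b(t),\boldsymbol s(t))$, where $\boldsymbol b(t)=(b_1(t),\dots,b_N(t))\in\mathbb Z_+^N$, $\boldsymbol s(t)=(s_1(t),\dots,s_N(t))\in\mathbb Z_+^N$; $b_i(t)$ is the number of buyers and $s_i(t)$ the number of sellers at level $i$. Given the state at time $t$, the state at time $t+1$ is obtained as follows, with all random choices independent (across levels, across traders, and of the past). (1) Trades: at each level $i$, the number $n_i$ of trades is binomial with $\min[b_i(t),s_i(t)]$ trials and success probability $p_{\rm T}$ (so $n_i=0$ if $b_i(t)=0$ or $s_i(t)=0$). Then $n_i$ buyers and $n_i$ sellers at level $i$ leave the market. (2) Each of the remaining $s_i(t)-n_i$ sellers at level $i$ quits the market with probability $p_{\rm Q}$, or moves to level $i-1$ with probability $p_{\rm M}$, or stays at level $i$ with probability $1-p_{\rm Q}-p_{\rm M}$. Each of the remaining $b_i(t)-n_i$ buyers at level $i$ quits the market with probability $p_{\rm Q}$, or moves to level $i+1$ with probability $p_{\rm M}$, or stays at level $i$ with probability $1-p_{\rm Q}-p_{\rm M}$. A seller moving down from level $1$ and a buyer moving up from level $N$ leave the market. Each trader is subject to at most one such move per time step. (3) Arrivals: a Poisson number with mean $\Lambda_{\rm b}$ of new buyers is added at level $1$, and a Poisson number with mean $\Lambda_{\rm s}$ of new sellers is added at level $N$. *)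

(* Defs.v *)
(* MathComp-Analysis *)
From HB Require Import structures.
From mathcomp Require Import all_boot all_order all_algebra.
From mathcomp Require Import all_classical all_reals all_analysis.

Set Implicit Arguments.
Unset Strict Implicit.
Unset Printing Implicit Defensive.

Import Order.TTheory GRing.Theory Num.Theory.
Import numFieldNormedType.Exports.

Local Open Scope classical_set_scope.
Local Open Scope ring_scope.

(* A transition kernel on a countable type [T] is given by its matrix
   [p : T -> T -> \bar R]; [\esum] is the (unordered) sum over a set. *)
Section MarkovChain.
Context {R : realType} {T : countType}.
Implicit Types (p : T -> T -> \bar R) (x y : T) (n : nat).

Fixpoint nstep p n x y : \bar R :=
  if n is n'.+1 then \esum_(z in [set: T]) (p x z * nstep p n' z y)%E
  else ((x == y)%:R)%:E.

Definition irreducible_chain p := forall x y, exists n, (0 < nstep p n x y)%E.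

(* [d = 1] is the only common divisor of the possible return times to [x]. *)
Definition aperiodic_chain p := forall x d,
  (forall n, (0 < n)%N -> (0 < nstep p n x x)%E -> (d %| n)%N) -> d = 1%N.

(* Probability that the chain started at [x] follows the path [s]. *)
Fixpoint path_prob p x (s : seq T) : \bar R :=
  if s is y :: s' then (p x y * path_prob p y s')%E else 1%E.

(* Probability that the first return time
   tau_x = inf {n >= 1 : X_n = x} of the chain started at [x] equals [n];
   [r] lists the states visited at times 1, ..., n - 1. *)
Definition first_return_prob p x n : \bar R :=
  \esum_(r in [set r : seq T | (size r).+1 = n /\ x \notin r])
    path_prob p x (rcons r x).

(* tau_x is almost surely finite, with finite expectation. *)
Definition positive_recurrent_chain p := forall x,
  (\sum_(0 <= n <oo) first_return_prob p x n = 1)%E /\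
  (\sum_(0 <= n <oo) (n%:R)%:E * first_return_prob p x n < +oo)%E.

Definition stationary_distribution p (pi : T -> R) :=
  [/\ forall x, 0 <= pi x,
      \esum_(x in [set: T]) (pi x)%:E = 1%E
    & forall y, \esum_(x in [set: T]) ((pi x)%:E * p x y)%E = (pi y)%:E].

(* The law of [X 0] is arbitrary. *)
Definition is_markov_chain p (d : measure_display) (Omega : measurableType d)
    (P : probability Omega R) (X : nat -> Omega -> T) :=
  (forall t x, measurable (X t @^-1` [set x])) /\
  (forall t (h : nat -> T),
     P [set w | forall r, (r <= t.+1)%N -> X r w = h r] =
     (P [set w | forall r, (r <= t)%N -> X r w = h r] *
      p (h t) (h t.+1))%E).

End MarkovChain.

Inductive action := Quit | Move | Stay.

Definition action_code (a : action) : option bool :=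
  match a with Quit => None | Move => Some true | Stay => Some false end.

Definition action_decode (c : option bool) : action :=
  match c with None => Quit | Some true => Move | Some false => Stay end.

Lemma action_codeK : cancel action_code action_decode.
Proof. by case. Qed.

HB.instance Definition _ := Countable.copy action (can_type action_codeK).

(* Numbers of buyers and of sellers at each level. Level [i : 'I_N] is the
   price level c_{i+1}. *)
Definition lob_state (N : nat) : countType :=
  ({ffun 'I_N -> nat} * {ffun 'I_N -> nat})%type.

(* Outcome (n, mb, ms, x, y) of all the random choices made in one time step:
   [n i] trades at level [i]; actions [mb i] and [ms i], one for each of the
   buyers and of the sellers that remain at level [i] after the trades;
   [x] new buyers and [y] new sellers. *)
Definition lob_outcome (N : nat) : countType :=
  ({ffun 'I_N -> nat} * {ffun 'I_N -> seq action} *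
   {ffun 'I_N -> seq action} * nat * nat)%type.

(* Buyers move up one level, sellers move down one level; those who move up
   from the top level, or down from the bottom level, are not counted. *)
Definition lob_next (N : nat) (w : lob_outcome N) : lob_state N :=
  let: (_, mb, ms, x, y) := w in
  ([ffun i : 'I_N => (count_mem Stay (mb i)
      + \sum_(j < N | j.+1 == i) count_mem Move (mb j)
      + (if val i == 0 then x else 0))%N],
   [ffun i : 'I_N => (count_mem Stay (ms i)
      + \sum_(j < N | val j == i.+1) count_mem Move (ms j)
      + (if i.+1 == N then y else 0))%N]).

Section LimitOrderBook.
Context {R : realType}.
Variables (N : nat) (Lb Ls pT pQ pM : R).

Definition action_prob (a : action) : R :=
  match a with Quit => pQ | Move => pM | Stay => 1 - pQ - pM end.

(* Joint probability of the independent actions of [k] traders. *)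
Definition actions_prob (k : nat) (s : seq action) : R :=
  if size s == k then \prod_(a <- s) action_prob a else 0.

(* Probability of an outcome given the current state; the factors express the
   independence of the choices. *)
Definition outcome_prob (u : lob_state N) (w : lob_outcome N) : R :=
  let: (b, s) := u in
  let: (n, mb, ms, x, y) := w in
  (\prod_(i < N) (binomial_pmf (minn (b i) (s i)) pT (n i)
                  * actions_prob (b i - n i) (mb i)
                  * actions_prob (s i - n i) (ms i)))
  * poisson_pmf Lb x * poisson_pmf Ls y.

Definition lob_kernel (u v : lob_state N) : \bar R :=
  \esum_(w in [set w | lob_next w = v]) (outcome_prob u w)%:E.

End LimitOrderBook.

(* Main.v *)
(* Let V be the number of traders in the book. Each trader quits with
   probability pQ at every step, so E[V(U(t+1)) | U(t)] <= (1 - pQ) V(U(t)) + Lb + Ls;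
   and from a book with V <= n the empty book is reached in one step with
   probability bounded below in terms of n. Hence two independent copies of
   the chain meet at the empty book after a time with geometric tails,
   and for a small weight c > 0 the distance d(u, v) = 1 + c (V(u) + V(v)),
   d(u, u) = 0, satisfies |P^n f(u) - P^n f(v)| <= rho^n d(u, v) for every
   f with values in [0, 1], with rho < 1. So P^n f converges uniformly in f,
   which yields the stationary law pi, its uniqueness, and convergence from
   every initial law. Positive recurrence follows from pi > 0: splitting
   according to the last visit to x gives the bound
   pi(x) * sum_k P_x(no return to x within k steps) <= 1. *)
Require Import Defs.
From mathcomp Require Import all_boot all_order all_algebra.
From mathcomp Require Import all_classical all_reals all_analysis.
From mathcomp Require Import ring lra.
Set Implicit Arguments.
Unset Strict Implicit.
Unset Printing Implicit Defensive.
Import Order.TTheory GRing.Theory Num.Theory.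
Import numFieldNormedType.Exports.
Local Open Scope classical_set_scope.
Local Open Scope ring_scope.
Local Open Scope ereal_scope.

(** The book is unbounded, so the chance of emptying it in one step has no positive lower bound over
    all states, and total variation need not contract by a fixed factor. The distance d repairs
    this: with few traders the meeting probability lowers the part 1, with many traders the drift
    lowers the part weighted by c. The weight must be small because near the empty book the drift
    may raise V by a constant. Independent copies can separate after meeting, but the estimate is
    needed only for distinct states, since equal states give equal values of P^n f; so no coupling
    of whole paths is built, only a double sum over one step. Uniformity in f keeps mass from
    escaping to infinity: indicators of all finite sets converge with the same error. Sums live in
    the extended reals, which removes summability conditions but makes subtraction awkward;
    closeness is therefore a pair of inequalities [x <= y + e] and [y <= x + e]. *)

Section Esum.
Context {R : realType}.

Lemma le_esum_term (T : choiceType) (D : set T) (a : T -> \bar R) i :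
  D i -> (forall i, 0 <= a i) -> a i <= \esum_(j in D) a j.
Proof.
move=> Di a0; apply: esum_ge; exists [set i]; last by rewrite fsbig_set1.
by split; [exact: finite_set1|move=> _ ->].
Qed.

Lemma esumZl (T : choiceType) (D : set T) (c : \bar R) (a : T -> \bar R) :
  0 <= c -> (forall i, 0 <= a i) ->
  \esum_(i in D) (c * a i) = c * \esum_(i in D) a i.
Proof.
case: c => [r| |//] r0 a0.
  rewrite /esum -ereal_supZl//; last first.
    by apply/set0P; exists 0, set0; [exact: fsets_set0|rewrite fsbig_set0].
  congr ereal_sup; apply/seteqP; split => [_ [F DF <-]|_ [_ [F DF <-] <-]] /=.
    by exists (\sum_(x \in F) a x); [exists F|rewrite ge0_mule_fsumr].
  by exists F => //; rewrite ge0_mule_fsumr.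
(* For [c = +oo] the convention [+oo * 0 = 0] settles a zero sum; otherwise one positive term makes
   both sides infinite. *)
have [s00|sgt0] := eqVneq (\esum_(i in D) a i) 0.
  rewrite s00 mule0 esum1// => i Di.
  suff -> : a i = 0 by rewrite mule0.
  by apply/eqP; rewrite eq_le a0 andbT -s00 le_esum_term.
have [i Di ai] : exists2 i, D i & 0 < a i.
  apply: contrapT => /forall2NP h; case/eqP: sgt0; apply: esum1 => i Di.
  case: (h i) => // /negP; rewrite -leNgt => ai.
  by apply/eqP; rewrite eq_le ai a0.
have -> : +oo * (\esum_(j in D) a j) = +oo.
  by rewrite gt0_mulye// lt_neqAle eq_sym sgt0 esum_ge0.
apply/eqP; rewrite -leye_eq -[leLHS](gt0_mulye ai).
by apply: (le_esum_term (a := fun i => +oo * a i)) => // j; rewrite mule_ge0.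
Qed.

Lemma exchange_esum (S T : choiceType) (a : S -> T -> \bar R) :
  (forall i j, 0 <= a i j) ->
  \esum_(i in [set: S]) \esum_(j in [set: T]) a i j =
  \esum_(j in [set: T]) \esum_(i in [set: S]) a i j.
Proof.
move=> a0; rewrite !esum_esum//.
rewrite (@reindex_esum R _ _ [set k | True /\ True] _ (fun k => (k.2, k.1)))//.
split => [? //|[? ?] [? ?] _ _ [-> ->]//|[i j] _].
by exists (j, i).
Qed.

Lemma esum_fibre (S T : choiceType) (g : S -> T) (a : S -> \bar R) :
  (forall i, 0 <= a i) ->
  \esum_(j in [set: T]) \esum_(i in [set i | g i = j]) a i =
  \esum_(i in [set: S]) a i.
Proof.
move=> a0; rewrite esum_esum//.
rewrite (@reindex_esum R _ _ [set: S] _ (fun i => (g i, i)))//.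
split => [i _//|i i' _ _ [_]//|[j i] [/= _ <-]]; by exists i.
Qed.

Lemma esum_prod (S T : choiceType) (a : S * T -> \bar R) :
  (forall k, 0 <= a k) ->
  \esum_(k in [set: S * T]) a k =
  \esum_(i in [set: S]) \esum_(j in [set: T]) a (i, j).
Proof.
move=> a0; rewrite esum_esum//.
rewrite [RHS](@reindex_esum R _ _ [set: S * T] _ id).
  by apply: eq_esum => -[].
by split => // -[i j] _; exists (i, j).
Qed.

Lemma esum_pred1 (T : choiceType) (y : T) (a : T -> \bar R) :
  0 <= a y -> \esum_(z in [set: T]) (a z * (z == y)%:R%:E) = a y.
Proof.
move=> ay; rewrite -[RHS](@esum_set1 R T y a) // [RHS]esum_mkcond.
apply: eq_esum => z _; case: eqP => [->|zy]; first by rewrite mem_set// mule1.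
by rewrite memNset// mule0.
Qed.

End Esum.

(** * Integration of nonnegative functions against a weight on a countable set *)

Section WeightedSum.
Context {R : realType} {T : countType}.
Implicit Types (w f g : T -> \bar R).

Definition wsum w f : \bar R := \esum_(z in [set: T]) (w z * f z).

Lemma wsum_ge0 w f : (forall z, 0 <= w z) -> (forall z, 0 <= f z) ->
  0 <= wsum w f.
Proof. by move=> w0 f0; apply: esum_ge0 => z _; rewrite mule_ge0. Qed.

Lemma le_wsum w f g : (forall z, 0 <= w z) -> (forall z, f z <= g z) ->
  wsum w f <= wsum w g.
Proof. by move=> w0 fg; apply: le_esum => z _; rewrite lee_wpmul2l. Qed.

Lemma eq_wsum w f g : f =1 g -> wsum w f = wsum w g.
Proof. by move=> fg; apply: eq_esum => z _; rewrite fg. Qed.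

Lemma wsumD w f g : (forall z, 0 <= w z) -> (forall z, 0 <= f z) ->
  (forall z, 0 <= g z) -> wsum w (fun z => f z + g z) = wsum w f + wsum w g.
Proof.
move=> w0 f0 g0; rewrite /wsum -esumD; [|by move=> z _; rewrite mule_ge0..].
by apply: eq_esum => z _; rewrite ge0_muleDr.
Qed.

Lemma wsumZ w f c : (forall z, 0 <= w z) -> (forall z, 0 <= f z) -> 0 <= c ->
  wsum w (fun z => c * f z) = c * wsum w f.
Proof.
move=> w0 f0 c0; rewrite /wsum -esumZl//; last by move=> z; rewrite mule_ge0.
by apply: eq_esum => z _; rewrite muleCA.
Qed.

Lemma wsum_cst w c : (forall z, 0 <= w z) -> 0 <= c ->
  \esum_(z in [set: T]) w z = 1 -> wsum w (fun=> c) = c.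
Proof.
move=> w0 c0 w1; rewrite /wsum -[RHS]mule1 -w1 -esumZl//.
by apply: eq_esum => z _; rewrite muleC.
Qed.

Lemma wsum_sum w (I : Type) (r : seq I) (F : I -> T -> \bar R) :
  (forall z, 0 <= w z) -> (forall i z, 0 <= F i z) ->
  wsum w (fun z => \sum_(i <- r) F i z) = \sum_(i <- r) wsum w (F i).
Proof.
move=> w0 F0; elim: r => [|i r IH].
  by rewrite big_nil /wsum esum1// => z _; rewrite big_nil mule0.
rewrite big_cons -IH -wsumD//; last by move=> z; rewrite sume_ge0.
by apply: eq_wsum => z; rewrite big_cons.
Qed.

Lemma wsum_pred1 w y : (forall z, 0 <= w z) ->
  wsum w (fun z => (z == y)%:R%:E) = w y.
Proof. by move=> w0; exact: esum_pred1. Qed.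

End WeightedSum.

(** * Constants of the contraction, and sequences with geometric increments *)

Section Contraction.
Context {R : realType}.
Local Open Scope ring_scope.

(** Here [s] stands for V(u) + V(v), [g] and [K] for the drift, and the square for the probability
    that independent copies meet. Up to [n] the meeting term pays for [2 * c * K]; beyond [n], half
    of the decrease [(1 - g) * s] does. *)
Lemma contraction_constants (g K : R) (a : nat -> R) :
    0 <= g < 1 -> 0 <= K -> (forall n, 0 < a n) ->
  exists n c rho, [/\ 0 < c, 0 <= rho < 1,
    forall s, 0 <= s <= n%:R ->
      1 + c * (g * s + 2 * K) <= rho * (1 + c * s) + Num.min (a n) 1 ^+ 2 &
    forall s, n%:R <= s -> 1 + c * (g * s + 2 * K) <= rho * (1 + c * s)].
Proof.
move=> /andP[g0 g1] K0 a0.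
(* The quotient gives [4 * K <= (1 - g) * n]; the [+ 1] gives [1 <= s] in the far case, so that
   [c * (1 - g) / 4] is dominated by a multiple of [s]. *)
have [n nK] : exists n, 4 * K / (1 - g) + 1 <= n%:R.
  exists (Num.bound (4 * K / (1 - g) + 1)); apply/ltW/archi_boundP.
  by rewrite addr_ge0// divr_ge0 ?mulr_ge0// subr_ge0 ltW.
have K4 : 0 <= 4 * K / (1 - g) by rewrite divr_ge0 ?mulr_ge0// subr_ge0 ltW.
have n1 : 1 <= n%:R :> R by lra.
have nK' : 4 * K <= (1 - g) * n%:R.
  by rewrite [leRHS]mulrC -ler_pdivrMr ?subr_gt0//; lra.
have [A AE] : exists A, A = Num.min (a n) 1 ^+ 2 by exists (Num.min (a n) 1 ^+ 2).
have A0 : 0 < A by rewrite AE exprn_gt0// lt_min a0 ltr01.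
have A1 : A <= 1.
  by rewrite AE exprn_ile1// ?ge_min ?lexx ?orbT// le_min ltW ?a0/=.
(* Half of the meeting probability [A] covers [2 * c * K]; the other half is left for [e]. *)
pose c := A / (4 * (K + 1)).
have cE : c * (4 * (K + 1)) = A by rewrite /c mulfVK// gt_eqF//; lra.
have c0 : 0 < c by rewrite divr_gt0//; lra.
clearbody c; have cK : 2 * c * K <= A / 2 .
  have -> : A / 2 = 2 * c * K + 2 * c by rewrite -cE; field.
  lra.
(* The first bound serves the near case, the last one the far case, and the middle one controls
   [e * (c * s)] in both. *)
pose e := Num.min (A / 2) (Num.min ((1 - g) / 4) (c * (1 - g) / 4)).
have [e1 e2 e3] : [/\ e <= A / 2, e <= (1 - g) / 4 & e <= c * (1 - g) / 4].
  by rewrite /e !ge_min !lexx ?orbT.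
have e0 : 0 < e.
  have : 0 < c * (1 - g) by rewrite mulr_gt0// subr_gt0.
  by rewrite /e !lt_min => ?; apply/and3P; split; lra.
clearbody e; exists n, c, (1 - e); rewrite -AE; split => //; first by apply/andP; split; lra.
- move=> s /andP[s0 _].
  have : 0 <= c * s * (1 - e - g) by rewrite !mulr_ge0 ?(ltW c0)//; lra.
  by nra.
- move=> s ns.
  have h1 : 4 * K <= (1 - g) * s by apply: le_trans nK' _; rewrite ler_wpM2l//; lra.
  have h2 : c * (4 * K) <= c * ((1 - g) * s) by rewrite ler_wpM2l// ltW.
  have h3 : c * (1 - g) * 1 <= c * (1 - g) * s.
    by rewrite ler_wpM2l ?mulr_ge0 ?(ltW c0)//; lra.
  have h4 : e * (c * s) <= (1 - g) / 4 * (c * s).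
    by rewrite ler_wpM2r ?mulr_ge0 ?(ltW c0)//; lra.
  by nra.
Qed.

(** With [D = C / (1 - rho)], the difference of [D * rho ^+ n] and [D * rho ^+ n.+1] is
    [C * rho ^+ n], so the intervals of radius [D * rho ^+ n] about [u n] are nested. The error is
    explicit because it has to be the same for all functions iterated. *)
Lemma geometric_cauchy_limit (u : nat -> R) (C rho : R) :
    0 <= rho < 1 -> 0 <= C ->
    (forall n, u n.+1 <= u n + C * rho ^+ n) ->
    (forall n, u n <= u n.+1 + C * rho ^+ n) ->
  exists l, forall n, u n <= l + C / (1 - rho) * rho ^+ n /\
                      l <= u n + C / (1 - rho) * rho ^+ n.
Proof.
move=> /andP[rho0 rho1] C0 u1 u2.
pose D := C / (1 - rho).
have DE : D * (1 - rho) = C by rewrite /D mulfVK// gt_eqF// subr_gt0.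
have D0 : 0 <= D by rewrite divr_ge0// subr_ge0 ltW.
have dn n : D * rho ^+ n = D * rho ^+ n.+1 + C * rho ^+ n.
  by rewrite -DE exprS; ring.
have p0 n : 0 <= D * rho ^+ n by rewrite mulr_ge0// exprn_ge0.
pose v n := u n + D * rho ^+ n; pose w n := u n - D * rho ^+ n.
have vn : {homo v : n m / (n <= m)%N >-> m <= n}.
  apply: homo_leq => // [x y z yx zy|n]; first exact: le_trans zy yx.
  by rewrite /v; have := u1 n; have := dn n; lra.
have wn : {homo w : n m / (n <= m)%N >-> n <= m}.
  apply: homo_leq => // [x y z|n]; first exact: le_trans.
  by rewrite /w; have := u2 n; have := dn n; lra.
have wv n m : w n <= v m.
  apply: le_trans (wn n (maxn n m) (leq_maxl _ _)) _.
  apply: le_trans _ (vn m (maxn n m) (leq_maxr _ _)).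
  by rewrite /w /v; have := p0 (maxn n m); lra.
have v0 : has_inf (range v).
  by split; [exists (v 0%N), 0%N|exists (w 0%N) => _ [m _ <-]].
exists (inf (range v)) => n; split.
- suff : w n <= inf (range v) by rewrite /w -/D; lra.
  by apply: lb_le_inf; [case: v0|move=> _ [m _ <-]].
- by apply: ge_inf; [case: v0|exists n].
Qed.

End Contraction.

(** * Iterates of the transition operator on functions, and n-step probabilities *)

Section Iterates.
Context {R : realType} {T : countType}.
Variable p : T -> T -> \bar R.
Hypothesis p_ge0 : forall x y, 0 <= p x y.
Hypothesis p_sum1 : forall x, \esum_(y in [set: T]) p x y = 1.
Implicit Types (f g : T -> \bar R) (x y u v : T) (n : nat).

Fixpoint iterE n f u : \bar R :=
  if n is n'.+1 then wsum (p u) (iterE n' f) else f u.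

Lemma iterE_ge0 n f : (forall z, 0 <= f z) -> forall u, 0 <= iterE n f u.
Proof. by move=> f0; elim: n => //= n IH u; exact: wsum_ge0. Qed.

Lemma le_iterE n f g : (forall z, f z <= g z) ->
  forall u, iterE n f u <= iterE n g u.
Proof. by move=> fg; elim: n => //= n IH u; exact: le_wsum. Qed.

Lemma iterE_cst n c u : 0 <= c -> iterE n (fun=> c) u = c.
Proof.
move=> c0; elim: n u => //= n IH u.
by rewrite (eq_wsum _ IH) wsum_cst.
Qed.

Lemma iterE_sum n (I : Type) (r : seq I) (F : I -> T -> \bar R) u :
  (forall i z, 0 <= F i z) ->
  iterE n (fun z => \sum_(i <- r) F i z) u = \sum_(i <- r) iterE n (F i) u.
Proof.
move=> F0; elim: n u => //= n IH u.
by rewrite (eq_wsum _ IH) wsum_sum// => i z; exact: iterE_ge0.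
Qed.

Lemma nstepE n x y : nstep p n x y = iterE n (fun z => (z == y)%:R%:E) x.
Proof. by elim: n x => //= n IH x; apply: eq_esum => z _; rewrite IH. Qed.

Lemma nstep_ge0 n x y : 0 <= nstep p n x y.
Proof. by rewrite nstepE iterE_ge0// => z; rewrite lee_fin. Qed.

Lemma nstep_le1 n x y : nstep p n x y <= 1.
Proof.
rewrite nstepE -[leRHS](@iterE_cst n _ x)//; apply: le_iterE => z.
by rewrite lee_fin lern1 leq_b1.
Qed.

(* The recursion of [iterE] is on the first step; here the last step is split
   off, as needed for stationarity. *)
Lemma iterE_nstep n f u : (forall z, 0 <= f z) ->
  iterE n f u = wsum (nstep p n u) f.
Proof.
move=> f0; elim: n u => [|n IH] u /=.
  rewrite /wsum (eq_esum (b := fun z => f z * (z == u)%:R%:E)) ?esum_pred1//.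
  by move=> z _; rewrite muleC eq_sym.
rewrite (eq_wsum _ IH) /wsum.
rewrite (eq_esum (b := fun z => \esum_(y in setT) (p u z * (nstep p n z y * f y)))); last first.
  by move=> z _; rewrite esumZl// => y; rewrite mule_ge0// nstep_ge0.
rewrite exchange_esum; last by move=> z y; rewrite !mule_ge0// nstep_ge0.
apply: eq_esum => y _; rewrite muleC -esumZl//; last first.
  by move=> z; rewrite mule_ge0// nstep_ge0.
by apply: eq_esum => z _; rewrite muleA muleC.
Qed.

Lemma nstepSr n u y : nstep p n.+1 u y = wsum (nstep p n u) (p ^~ y).
Proof.
rewrite -iterE_nstep// nstepE.
elim: n u => [u|n IH u /=]; first by rewrite /= wsum_pred1.
by apply: eq_wsum => z; rewrite -IH.
Qed.

Lemma nstep_sum1 n x : \esum_(y in [set: T]) nstep p n x y = 1.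
Proof.
rewrite -(@iterE_cst n 1 x)// iterE_nstep//.
by apply: eq_esum => z _; rewrite mule1.
Qed.

(** * Contraction in the weighted distance from drift and minorization *)

Section Drift.
Variables (V : T -> nat) (g K : R) (o : T) (a : nat -> R).
Hypothesis g01 : (0 <= g < 1)%R.
Hypothesis K_ge0 : (0 <= K)%R.
Hypothesis a_gt0 : forall n, (0 < a n)%R.
Hypothesis drift : forall u,
  wsum (p u) (fun z => (V z)%:R%:E) <= (g * (V u)%:R + K)%:E.
Hypothesis minor : forall n u, (V u <= n)%N -> (a n)%:E <= p u o.

Definition wdist (c : R) u v : R :=
  if u == v then 0%R else (1 + c * ((V u)%:R + (V v)%:R))%R.

Lemma wdist_ge0 c u v : (0 <= c)%R -> (0 <= wdist c u v)%R.
Proof.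
by move=> c0; rewrite /wdist; case: ifP => // _; rewrite addr_ge0// mulr_ge0.
Qed.

(* Two independent copies started at [u] and [v] meet at [o] with probability
   [p u o * p v o], where [wdist] vanishes. *)
Lemma wdist_step c u v : (0 <= c)%R ->
  wsum (p u) (fun y => wsum (p v) (fun z => (wdist c y z)%:E)) + p u o * p v o
  <= (1 + c * (g * ((V u)%:R + (V v)%:R) + 2 * K))%:E.
Proof.
move=> c0.
have lin (x : T) (d : R) : (0 <= d)%R ->
    wsum (p x) (fun z => (d + c * (V z)%:R)%:E) <=
    (d + c * (g * (V x)%:R + K))%:E.
  move=> d0; under eq_wsum do rewrite EFinD EFinM.
  rewrite wsumD//; last by move=> z; rewrite mule_ge0 ?lee_fin.
  rewrite wsum_cst// EFinD leeD2l// wsumZ ?lee_fin//.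
  by rewrite EFinM lee_wpmul2l ?lee_fin.
have ind0 (x z : T) : 0 <= ((z == x)%:R : R)%:E by rewrite lee_fin.
have gK x : (0 <= g * (V x)%:R + K)%R.
  by case/andP: g01 => g0 _; rewrite addr_ge0// mulr_ge0.
(* Both factors of the meeting probability, here for [u] and below for [v], become sums of
   indicators; the claim is then pointwise in [y] and [z]. *)
rewrite muleC -(wsum_pred1 o (p_ge0 u)) -wsumZ// -wsumD//; first last.
- by move=> z; rewrite mule_ge0.
- by move=> z; apply: wsum_ge0 => // t; rewrite lee_fin wdist_ge0.
apply: le_trans (_ : _ <=
  wsum (p u) (fun y => ((1 + c * (g * (V v)%:R + K)) + c * (V y)%:R)%:E)) _.
  apply: le_wsum => // y.
  rewrite muleC -(wsum_pred1 o (p_ge0 v)) -wsumZ// -wsumD//; last first.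
    by move=> z; rewrite lee_fin wdist_ge0.
  apply: le_trans (_ : _ <=
    wsum (p v) (fun z => ((1 + c * (V y)%:R) + c * (V z)%:R)%:E)) _.
    apply: le_wsum => // z; rewrite -EFinM -EFinD lee_fin /wdist.
    have cy : (0 <= c * (V y)%:R)%R by rewrite mulr_ge0.
    have cz : (0 <= c * (V z)%:R)%R by rewrite mulr_ge0.
    (* On the diagonal the distance is 0 and the product of indicators at most 1; off it [y] and [z]
       cannot both be [o]. *)
    have [->|yz] := eqVneq y z.
      by case: (z == o); rewrite /= ?mulr1 ?mulr0; lra.
    have -> : ((y == o)%:R * (z == o)%:R = 0 :> R)%R.
      case: eqP => [yo|]; rewrite ?mul0r//.
      by case: eqP => [zo|]; rewrite ?mulr0//; rewrite yo zo eqxx in yz.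
    by lra.
  apply: le_trans (lin _ _ _) _; first by rewrite addr_ge0// mulr_ge0.
  by rewrite lee_fin; lra.
by apply: le_trans (lin _ _ _) _; rewrite ?addr_ge0 ?mulr_ge0// lee_fin; lra.
Qed.

(** If V(u) + V(v) is at most [n], the minorization applies to both states and the meeting
    probability is subtracted; beyond [n] it is dropped and the drift suffices. *)
Lemma wdist_contraction : exists c rho, [/\ (0 < c)%R, (0 <= rho < 1)%R &
  forall u v, u != v ->
    wsum (p u) (fun y => wsum (p v) (fun z => (wdist c y z)%:E)) <=
    (rho * wdist c u v)%:E].
Proof.
have [n [c [rho [c0 rho01 small big]]]] := contraction_constants g01 K_ge0 a_gt0.
exists c, rho; split => // u v uv; rewrite /wdist (negbTE uv).
have := wdist_step u v (ltW c0).
set X := wsum _ _ => Xle.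
have [s_n|/ltW s_n] := leP ((V u)%:R + (V v)%:R)%R (n%:R : R).
  have mn x : (V x <= n)%N -> (Num.min (a n) 1)%:E <= p x o.
    by move=> Vx; apply: le_trans (minor Vx); rewrite lee_fin ge_min lexx.
  have m0 : (0 <= Num.min (a n) 1)%R by rewrite le_min ltW/=.
  have mm : (Num.min (a n) 1 ^+ 2)%:E <= p u o * p v o.
    rewrite expr2 EFinM lee_pmul ?lee_fin// mn//;
      by rewrite -(ler_nat R); apply: le_trans s_n; rewrite ?lerDl ?lerDr.
  have := le_trans (leeD2l X mm) Xle.
  rewrite -leeBrDr// => /le_trans; apply; rewrite -EFinB lee_fin.
  by have := small _ (introT andP (conj _ s_n)); rewrite addr_ge0// => /(_ isT); lra.
apply: le_trans (leeDl _ _) (le_trans Xle _); first by rewrite mule_ge0.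
by rewrite lee_fin big.
Qed.

(** A function with values in [0, 1] is 1-Lipschitz for [wdist], and each step multiplies the
    Lipschitz constant by [rho]: two one-step averages are compared by averaging over independent
    pairs. One inequality is enough, as [u] and [v] may be exchanged. *)
Lemma iterE_contraction : exists c rho, [/\ (0 < c)%R, (0 <= rho < 1)%R &
  forall f, (forall z, 0 <= f z <= 1) -> forall n u v,
    iterE n f u <= iterE n f v + (rho ^+ n * wdist c u v)%:E].
Proof.
have [c [rho [c0 rho01 contr]]] := wdist_contraction.
exists c, rho; split => // f f01.
have f0 z : 0 <= f z by case/andP: (f01 z).
have cV u v : (0 <= c * ((V u)%:R + (V v)%:R))%R by rewrite mulr_ge0 ?addr_ge0 ?(ltW c0)//.
have d0 u v : (0 <= wdist c u v)%R by rewrite wdist_ge0// ltW.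
have rho0 n : (0 <= rho ^+ n)%R by case/andP: rho01 => *; rewrite exprn_ge0.
(* Equal states are set apart: independent copies started there may separate, so [contr] excludes
   them, but the claim is trivial. *)
elim=> [|n IH] u v; have [->|uv] := eqVneq u v.
- by rewrite leeDl// lee_fin mulr_ge0.
- case/andP: (f01 u) => _ fu1; rewrite expr0 mul1r /wdist (negbTE uv) /=.
  apply: le_trans fu1 (le_trans _ (leeDr _ (f0 v))).
  by rewrite lee_fin lerDl.
- by rewrite leeDl// lee_fin mulr_ge0.
rewrite /=.
rewrite (@eq_wsum _ _ (p u) _ (fun y => wsum (p v) (fun=> iterE n f y))); last first.
  by move=> y; rewrite wsum_cst// iterE_ge0.
apply: le_trans (_ : _ <= wsum (p u) (fun y => wsum (p v) (fun z =>
    iterE n f z + (rho ^+ n * wdist c y z)%:E))) _.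
  by apply: le_wsum => // y; exact: le_wsum.
rewrite (@eq_wsum _ _ (p u) _ (fun y => wsum (p v) (iterE n f) +
    (rho ^+ n)%:E * wsum (p v) (fun z => (wdist c y z)%:E))); last first.
  move=> y; rewrite wsumD//; first last.
  - by move=> z; rewrite lee_fin mulr_ge0.
  - by move=> z; rewrite iterE_ge0.
  congr (_ + _); under eq_wsum do rewrite EFinM.
  by rewrite wsumZ ?lee_fin// => z; rewrite lee_fin.
have w0 y : 0 <= wsum (p v) (fun z => (wdist c y z)%:E).
  by apply: wsum_ge0 => // z; rewrite lee_fin.
rewrite wsumD//; first last.
- by move=> z; rewrite mule_ge0 ?lee_fin.
- by move=> z; apply: wsum_ge0 => // t; rewrite iterE_ge0.
rewrite wsum_cst//; last by apply: wsum_ge0 => // t; rewrite iterE_ge0.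
rewrite leeD2l// wsumZ ?lee_fin// exprSr -mulrA EFinM lee_wpmul2l ?lee_fin//.
exact: contr.
Qed.

(** The next iterate at [o] averages the current one over a step from [o], so the values at [o] have
    geometric increments; the contraction carries their limit to every [u]. The order of quantifiers
    matters: [rho] and [B] are fixed before [f]. *)
Lemma geometric_ergodicity : exists (rho : R) (B : T -> R),
  [/\ (0 <= rho < 1)%R, (forall u, (0 <= B u)%R) &
  forall f, (forall z, 0 <= f z <= 1) -> exists l : R, forall n u,
    iterE n f u <= (l + B u * rho ^+ n)%:E /\
    l%:E <= iterE n f u + (B u * rho ^+ n)%:E].
Proof.
have [c [rho [c0 rho01 contr]]] := iterE_contraction.
have [g0 _] := andP g01; have [rho0 rho1] := andP rho01.
(* Bounds the mean distance from [o] after one step out of [o]. *)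
pose C : R := (1 + c * ((V o)%:R + (g * (V o)%:R + K)))%R.
pose D : R := (C / (1 - rho))%R.
have C0 : (0 <= C)%R.
  by rewrite addr_ge0// mulr_ge0 ?(ltW c0)// ?addr_ge0// ?addr_ge0// mulr_ge0.
have D0 : (0 <= D)%R by rewrite divr_ge0// subr_ge0 ltW.
have d0 u v : (0 <= wdist c u v)%R by rewrite wdist_ge0// ltW.
have rn n : (0 <= rho ^+ n)%R by rewrite exprn_ge0.
exists rho, (fun u => D + wdist c u o)%R; split => //.
  by move=> u; rewrite addr_ge0.
move=> f f01.
have f0 z : 0 <= f z by case/andP: (f01 z).
have fin n u : iterE n f u = (fine (iterE n f u))%:E.
  rewrite fineK// ge0_fin_numE ?iterE_ge0//.
  apply: le_lt_trans (ltry 1); rewrite -[leRHS](@iterE_cst n _ u)//.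
  by apply: le_iterE => z; case/andP: (f01 z).
have dC : wsum (p o) (fun z => (wdist c z o)%:E) <= C%:E.
  apply: le_trans (_ : _ <= wsum (p o) (fun z =>
      (1 + c * (V o)%:R)%:E + c%:E * (V z)%:R%:E)) _.
    apply: le_wsum => // z; rewrite -EFinM -EFinD lee_fin /wdist.
    have cz x : (0 <= c * (V x)%:R)%R by rewrite mulr_ge0 // ltW.
    by have := cz z; have := cz o; case: eqP => _; lra.
  rewrite wsumD//; first last.
  - by move=> z; rewrite mule_ge0 ?lee_fin// ltW.
  - by move=> z; rewrite lee_fin addr_ge0// mulr_ge0 // ltW.
  rewrite wsum_cst//; last by rewrite lee_fin addr_ge0// mulr_ge0 // ltW.
  rewrite wsumZ// ?lee_fin ?(ltW c0)//.
  rewrite /C mulrDr addrA [leRHS]EFinD leeD2l// [leRHS]EFinM.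
  by rewrite lee_wpmul2l ?lee_fin ?(ltW c0).
have wC n : wsum (p o) (fun z => (rho ^+ n * wdist c z o)%:E) <= (C * rho ^+ n)%:E.
  under eq_wsum do rewrite EFinM.
  rewrite wsumZ ?lee_fin//; last by move=> z; rewrite lee_fin.
  by rewrite mulrC EFinM lee_wpmul2l ?lee_fin.
have wsym n : wsum (p o) (fun z => (rho ^+ n * wdist c o z)%:E) =
              wsum (p o) (fun z => (rho ^+ n * wdist c z o)%:E).
  by apply: eq_wsum => z; rewrite /wdist eq_sym [((V o)%:R + _)%R]addrC.
have [l lP] : exists l, forall n,
    (fine (iterE n f o) <= l + D * rho ^+ n)%R /\
    (l <= fine (iterE n f o) + D * rho ^+ n)%R.
  apply: (@geometric_cauchy_limit R (fun n => fine (iterE n f o))) => // n.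
  - rewrite -lee_fin EFinD -!fin /=.
    apply: le_trans (_ : _ <= wsum (p o) (fun z =>
      iterE n f o + (rho ^+ n * wdist c z o)%:E)) _; first by apply: le_wsum => // z; exact: contr.
    rewrite wsumD//; first last.
    - by move=> z; rewrite lee_fin mulr_ge0.
    - by move=> z; rewrite iterE_ge0.
    by rewrite wsum_cst ?iterE_ge0// leeD2l.
  - rewrite -lee_fin EFinD -!fin /=.
    rewrite -[leLHS](@wsum_cst _ _ (p o))// ?iterE_ge0//.
    apply: le_trans (_ : _ <= wsum (p o) (fun z =>
      iterE n f z + (rho ^+ n * wdist c o z)%:E)) _; first by apply: le_wsum => // z; exact: contr.
    rewrite wsumD//; first last.
    - by move=> z; rewrite lee_fin mulr_ge0.
    - by move=> z; rewrite iterE_ge0.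
    by rewrite leeD2l// wsym.
exists l => n u; have [l1 l2] := lP n.
have := contr f f01 n u o; have := contr f f01 n o u.
rewrite [wdist c o u](_ : _ = wdist c u o); last first.
  by rewrite /wdist eq_sym [((V o)%:R + _)%R]addrC.
by rewrite (fin n u) (fin n o) -!EFinD !lee_fin => h1 h2; split; lra.
Qed.

End Drift.
End Iterates.

(** The slack [e], with a [b] depending on it, is what truncating an initial law to a finite set
    leaves behind. *)
Lemma cvg_up_to_geometric (R : realType) (X : nat -> \bar R) (l rho : R) :
    (0 <= rho < 1)%R ->
    (forall e : R, (0 < e)%R -> exists2 b : R, (0 <= b)%R & forall n,
      X n <= (l + b * rho ^+ n + e)%:E /\ l%:E <= X n + (b * rho ^+ n + e)%:E) ->
  X n @[n --> \oo] --> l%:E.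
Proof.
move=> /andP[rho0 rho1] H.
have fin n : X n \is a fin_num.
  have [b b0 /(_ n)[h1 h2]] := H 1%R ltr01.
  rewrite fin_numE; apply/andP; split; apply/eqP => Xn.
    by move: h2; rewrite Xn.
  by move: h1; rewrite Xn leye_eq.
apply/fine_cvgP; split; first by apply: nearW.
apply/cvgrPdist_le => e e0.
have e2 : (0 < e / 2)%R by rewrite divr_gt0.
have [b b0 bP] := H _ e2.
have : (b * rho ^+ n)%R @[n --> \oo] --> (b * 0)%R.
  by apply: cvgMr; apply: cvg_expr; rewrite ger0_norm.
rewrite mulr0 => /cvgrPdist_le /(_ _ e2); apply: filterS => n /=.
rewrite sub0r normrN ger0_norm ?mulr_ge0 ?exprn_ge0// => h.
have [h1 h2] := bP n.
move: h1 h2; rewrite -[X n]fineK// -EFinD !lee_fin => h1 h2.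
by rewrite ler_norml; apply/andP; split; lra.
Qed.

Lemma lee_up_to_geometric (R : realType) (x : \bar R) (l b rho : R) :
    (0 <= rho < 1)%R -> (0 <= b)%R ->
    (forall n, x <= (l + b * rho ^+ n)%:E) -> x <= l%:E.
Proof.
move=> /andP[rho0 rho1] b0 H; apply/lee_addgt0Pr => e e0.
have : (b * rho ^+ n)%R @[n --> \oo] --> (b * 0)%R.
  by apply: cvgMr; apply: cvg_expr; rewrite ger0_norm.
rewrite mulr0 => /cvgrPdist_le /(_ _ e0)[n _ /(_ n (leqnn n))] /=.
rewrite sub0r normrN ger0_norm ?mulr_ge0 ?exprn_ge0// => h.
by apply: le_trans (H n) _; rewrite -EFinD lee_fin lerD2l.
Qed.

(** * The limit law, its stationarity, and convergence from any initial law *)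

Section LimitLaw.
Context {R : realType} {T : countType}.
Variable p : T -> T -> \bar R.
Hypothesis p_ge0 : forall x y, 0 <= p x y.
Hypothesis p_sum1 : forall x, \esum_(y in [set: T]) p x y = 1.
Implicit Types (f g : T -> \bar R) (x y u v : T) (n : nat).

Lemma stationary_nstep (pi : T -> R) n y : stationary_distribution p pi ->
  wsum (EFin \o pi) (fun v => nstep p n v y) = (pi y)%:E.
Proof.
move=> [pi0 _ piS]; elim: n => [|n IH].
  by rewrite wsum_pred1// => z; rewrite lee_fin.
rewrite -IH /wsum /=.
rewrite (eq_esum (b := fun v => \esum_(z in setT)
    ((pi v)%:E * (p v z * nstep p n z y)))); last first.
  move=> v _; rewrite esumZl ?lee_fin// => z; rewrite mule_ge0//.
  exact: nstep_ge0.
rewrite exchange_esum; last first.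
  by move=> v z; rewrite !mule_ge0 ?lee_fin//; exact: nstep_ge0.
apply: eq_esum => z _; rewrite -piS muleC -esumZl; last 2 first.
- exact: nstep_ge0.
- by move=> v; rewrite mule_ge0 ?lee_fin.
by apply: eq_esum => v _; rewrite muleA muleC.
Qed.

Variables (o : T) (rho : R) (B : T -> R).
Hypothesis rho01 : (0 <= rho < 1)%R.
Hypothesis B_ge0 : forall u, (0 <= B u)%R.
Hypothesis ergodic : forall f, (forall z, 0 <= f z <= 1) ->
  exists l : R, forall n u,
    iterE p n f u <= (l + B u * rho ^+ n)%:E /\
    l%:E <= iterE p n f u + (B u * rho ^+ n)%:E.

Let rn n : (0 <= B o * rho ^+ n)%R.
Proof. by case/andP: rho01 => ? _; rewrite mulr_ge0// exprn_ge0. Qed.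

(** Pointwise limits could lose mass and be only sub-stationary. The error bound common to all
    indicators of finite sets gives total mass 1, and the mass then forces equality in the
    stationarity inequality. *)
Lemma limit_law : exists pi : T -> R,
  stationary_distribution p pi /\ forall n u y,
    nstep p n u y <= (pi y + B u * rho ^+ n)%:E /\
    (pi y)%:E <= nstep p n u y + (B u * rho ^+ n)%:E.
Proof.
have ind01 y (z : T) : 0 <= ((z == y)%:R : R)%:E <= 1.
  by rewrite !lee_fin ler0n lern1 leq_b1.
have [pi piP] := choice (fun y => ergodic (ind01 y)).
have {}piP n u y : nstep p n u y <= (pi y + B u * rho ^+ n)%:E /\
    (pi y)%:E <= nstep p n u y + (B u * rho ^+ n)%:E.
  by rewrite nstepE; exact: piP.
exists pi; split => //.
have cvgpi y : nstep p n o y @[n --> \oo] --> (pi y)%:E.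
  apply: cvg_up_to_geometric rho01 _ => e e0; exists (B o) => // n.
  have [h1 h2] := piP n o y; split.
    by apply: le_trans h1 _; rewrite lee_fin lerDl ltW.
  by apply: le_trans h2 _; rewrite leeD2l// lee_fin lerDl ltW.
have pi0 y : (0 <= pi y)%R.
  rewrite -lee_fin -(cvg_lim _ (cvgpi y))//; apply: lime_ge.
    by apply/cvg_ex; exists (pi y)%:E.
  by apply: nearW => n; exact: nstep_ge0.
pose S (r : seq T) n := \sum_(y <- r) nstep p n o y.
(* The limit for the indicator of [r] equals the sum of the limits at its points, with an error that
   does not grow with [r]. *)
have SP (r : seq T) : uniq r -> forall n,
    S r n <= \sum_(y <- r) (pi y)%:E + (B o * rho ^+ n)%:E /\
    \sum_(y <- r) (pi y)%:E <= S r n + (B o * rho ^+ n)%:E.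
  move=> ur; pose f (z : T) : \bar R := \sum_(y <- r) (z == y)%:R%:E.
  have fE z : f z = (z \in r)%:R%:E.
    rewrite /f sumEFin -natr_sum; congr (_%:R%:E).
    by rewrite -(count_uniq_mem _ ur) -sum1_count [RHS]big_mkcond/=;
       apply: eq_bigr => y _; rewrite /= eq_sym; case: eqP.
  have f01 z : 0 <= f z <= 1 by rewrite fE !lee_fin ler0n lern1 leq_b1.
  have [l lP] := ergodic f01.
  have SE n : S r n = iterE p n f o.
    rewrite iterE_sum// /S.
    by apply: eq_bigr => y _; rewrite nstepE.
  have Sl : S r n @[n --> \oo] --> l%:E.
    apply: cvg_up_to_geometric rho01 _ => e e0; exists (B o) => // n.
    rewrite SE; have [h1 h2] := lP n o; split.
      by apply: le_trans h1 _; rewrite lee_fin lerDl ltW.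
    by apply: le_trans h2 _; rewrite leeD2l// lee_fin lerDl ltW.
  have Spi : S r n @[n --> \oo] --> \sum_(y <- r) (pi y)%:E.
    apply: (cvg_nnesum (f := fun y n => nstep p n o y)) => y _.
      by apply: nearW => n; exact: nstep_ge0.
    exact: cvgpi.
  have <- : l%:E = \sum_(y <- r) (pi y)%:E by apply: cvg_unique Sl Spi.
  by move=> n; rewrite SE; have [h1 h2] := lP n o; rewrite -EFinD.
have piS : \esum_(x in [set: T]) (pi x)%:E = 1.
  apply/eqP; rewrite eq_le; apply/andP; split.
    apply: ge_ereal_sup => _ [F [finF _] <-]; rewrite fsbig_finite//=.
    apply: (@lee_up_to_geometric _ _ 1 (B o) rho) => // n.
    have [_ /le_trans] := SP _ (finmap.fset_uniq (fset_set F)) n; apply.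
    rewrite EFinD leeD2r// -(nstep_sum1 p_ge0 p_sum1 n o); apply: esum_ge.
    by exists F; [split|rewrite fsbig_finite].
  have esfin : 0 <= \esum_(x in [set: T]) (pi x)%:E.
    by apply: esum_ge0 => y _; rewrite lee_fin.
  case E : (\esum_(x in [set: T]) (pi x)%:E) esfin => [s| |] // _; last first.
    by rewrite leey.
  apply: (@lee_up_to_geometric _ _ s (B o) rho) => // n.
  rewrite -(nstep_sum1 p_ge0 p_sum1 n o).
  apply: ge_ereal_sup => _ [F [finF _] <-]; rewrite fsbig_finite//=.
  have [/le_trans h _] := SP _ (finmap.fset_uniq (fset_set F)) n; apply: h.
  rewrite EFinD leeD2r// -E; apply: esum_ge.
  by exists F; [split|rewrite fsbig_finite].
split => //.
have pp0 x y : 0 <= (pi x)%:E * p x y by rewrite mule_ge0 ?lee_fin.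
(* On a fixed finite set the error may grow with the size of [r], since only then does [n] tend to
   infinity. *)
have sub y : \esum_(x in [set: T]) ((pi x)%:E * p x y) <= (pi y)%:E.
  apply: ge_ereal_sup => _ [F [finF _] <-]; rewrite fsbig_finite//=.
  set r : seq T := finmap.enum_fset (fset_set F).
  apply: (@lee_up_to_geometric _ _ (pi y) (B o * (1 + (size r)%:R)) rho) => //.
    by rewrite mulr_ge0.
  move=> n.
  apply: le_trans (_ : _ <=
      \sum_(x <- r) (nstep p n o x * p x y + (B o * rho ^+ n)%:E)) _.
    apply: lee_sum => x _.
    apply: le_trans (_ : _ <= (nstep p n o x + (B o * rho ^+ n)%:E) * p x y) _.
      by rewrite lee_wpmul2r//; have [] := piP n o x.
    rewrite ge0_muleDl ?lee_fin ?nstep_ge0// leeD2l//.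
    rewrite -[leRHS]mule1 lee_wpmul2l ?lee_fin//.
    by rewrite -(p_sum1 x) le_esum_term.
  rewrite big_split /= sumEFin big_const_seq count_predT iter_addr_0.
  apply: le_trans (_ : _ <=
      (pi y + B o * rho ^+ n.+1)%:E + (B o * rho ^+ n *+ size r)%:E) _.
    rewrite leeD2r//; have [/(le_trans _) h _] := piP n.+1 o y; apply: h.
    rewrite nstepSr// /wsum; apply: esum_ge.
    by exists F; [split|rewrite fsbig_finite].
  rewrite -EFinD lee_fin -mulr_natr.
  have : (B o * rho ^+ n.+1 <= B o * rho ^+ n)%R.
    case/andP: rho01 => rho0 /ltW rho1.
    by rewrite ler_wpM2l// exprS ler_piMl// exprn_ge0.
  by lra.
(* Both sides have total mass 1, so a deficit [d] at [y0] would give [1 + d <= 1]. *)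
move=> y0; apply/eqP; rewrite eq_le sub /= leNgt; apply/negP => lt0.
pose E (y : T) : \bar R := \esum_(x in [set: T]) ((pi x)%:E * p x y)%E.
rewrite -/(E y0) in lt0.
have Efin y : E y = (fine (E y))%:E.
  rewrite fineK// ge0_fin_numE ?esum_ge0//.
  exact: le_lt_trans (sub y) (ltry _).
pose d : R := (pi y0 - fine (E y0))%R.
have d0 : (0 < d)%R by rewrite subr_gt0 -lte_fin -Efin.
have : \esum_(y in [set: T]) (E y + d%:E * (y == y0)%:R%:E) <=
       \esum_(y in [set: T]) (pi y)%:E.
  apply: le_esum => y _; case: eqP => [->|_]; last by rewrite mule0 adde0; exact: sub.
  by rewrite mule1 Efin -EFinD lee_fin /d; lra.
rewrite piS esumD; last 2 first.
- by move=> y _; apply: esum_ge0.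
- by move=> y _; rewrite mule_ge0 ?lee_fin// ltW.
rewrite (@esum_pred1 _ _ y0 (fun=> d%:E)) ?lee_fin ?(ltW d0)//.
rewrite /E exchange_esum// (eq_esum (b := fun x => (pi x)%:E)).
  by rewrite piS -EFinD lee_fin; lra.
by move=> x _; rewrite esumZl ?p_sum1 ?mule1 ?lee_fin.
Qed.

(** [B] may be unbounded, so no rate is common to all initial laws. A finite set carrying mass
    [1 - e] has the common constant [b]; the rest costs at most [e] because all probabilities lie in
    [0, 1]. *)
Lemma initial_law_cvg (pi : T -> R) (nu : T -> \bar R) y :
    (0 <= pi y)%R ->
    (forall n u, nstep p n u y <= (pi y + B u * rho ^+ n)%:E /\
      (pi y)%:E <= nstep p n u y + (B u * rho ^+ n)%:E) ->
    (forall v, 0 <= nu v) -> \esum_(v in [set: T]) nu v = 1 ->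
  wsum nu (fun v => nstep p n v y) @[n --> \oo] --> (pi y)%:E.
Proof.
move=> pi0 piP nu0 nu1; apply: cvg_up_to_geometric rho01 _ => e e0.
have [rho0 rho1] := andP rho01.
have [F [finF _] Fe] : exists2 F, fsets [set: T] F &
    (1 - e)%:E < \sum_(x \in F) nu x.
  have : (1 - e)%:E < \esum_(v in [set: T]) nu v.
    by rewrite nu1 lte_fin; lra.
  by move=> /ereal_sup_gt[_ [F FT <-]] ?; exists F.
pose r : seq T := finmap.enum_fset (fset_set F).
pose b : R := (\sum_(v <- r) B v)%R.
have b0 : (0 <= b)%R by rewrite sumr_ge0.
have bB v : v \in r -> (B v <= b)%R.
  move=> vr; rewrite /b (big_rem v)//= lerDl sumr_ge0//.
have brn n : (0 <= b * rho ^+ n)%R by rewrite mulr_ge0// exprn_ge0.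
pose out (v : T) : \bar R := (v \notin r)%:R%:E.
have out0 v : 0 <= out v by rewrite lee_fin.
have oute : wsum nu out <= e%:E.
  have : wsum nu (fun v => (v \in r)%:R%:E) + wsum nu out = 1.
    rewrite -wsumD// -(@wsum_cst _ _ nu 1)//.
    by apply: eq_wsum => v; rewrite /out -EFinD -natrD; case: (v \in r).
  have : (1 - e)%:E <= wsum nu (fun v => (v \in r)%:R%:E).
    apply: le_trans (ltW Fe) _; rewrite fsbig_finite//= /wsum; apply: esum_ge.
    exists F => //; rewrite fsbig_finite//= big_seq [leRHS]big_seq.
    by apply: lee_sum => v vr; rewrite -/r in vr *; rewrite vr mule1.
  have w0 : 0 <= wsum nu out by apply: wsum_ge0.
  have w1 : 0 <= wsum nu (fun v => (v \in r)%:R%:E).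
    by apply: wsum_ge0 => // v; rewrite lee_fin.
  case: (wsum nu out) w0 => [s| |] //; case: (wsum nu _) w1 => [t| |] //.
  by rewrite !lee_fin => _ _ h [h']; lra.
exists b => // n.
have wE (f : T -> \bar R) c : (forall v, 0 <= f v) -> (0 <= c)%R ->
    wsum nu (fun v => f v + c%:E + out v) <= wsum nu f + c%:E + e%:E.
  move=> f0 c0; rewrite wsumD//; last by move=> v; rewrite adde_ge0 ?lee_fin.
  rewrite wsumD// ?(wsum_cst nu0) ?lee_fin//.
  by rewrite leeD2l.
have case_r v : (B v * rho ^+ n)%:E <= (b * rho ^+ n)%:E \/ out v = 1.
  rewrite /out; case: (boolP (v \in r)) => [/bB vb|_]; last by right.
  by left; rewrite lee_fin ler_wpM2r// exprn_ge0.
split.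
- rewrite !EFinD -[X in _ <= X + _ + _](wsum_cst nu0 _ nu1) ?lee_fin//.
  apply: le_trans (wE _ _ _ _) => //.
  apply: le_wsum => // v; have [h|->] := case_r v.
    have [/le_trans k _] := piP n v; apply: k.
    by rewrite EFinD -[leLHS]adde0 leeD// leeD2l.
  apply: le_trans (nstep_le1 p_ge0 p_sum1 n v y) _.
  by rewrite leeDr// adde_ge0 ?lee_fin.
- rewrite EFinD addeA -[leLHS](wsum_cst nu0 _ nu1) ?lee_fin//.
  apply: le_trans (wE _ _ _ _) => //; last by move=> v; exact: nstep_ge0.
  apply: le_wsum => // v; have [h|->] := case_r v.
    have [_ /le_trans k] := piP n v; apply: k.
    by rewrite -[leLHS]adde0 leeD// leeD2l.
  apply: le_trans (_ : _ <= 1) _; last first.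
    by rewrite leeDr// adde_ge0 ?lee_fin// nstep_ge0.
  (* [pi y] is at most 1 as a limit of probabilities. *)
  apply: (@lee_up_to_geometric _ _ 1 (B o) rho) => // m.
  have [_ /le_trans k] := piP m o; apply: k.
  by rewrite EFinD leeD2r// nstep_le1.
Qed.

End LimitLaw.

(** * Return times and positive recurrence *)

Section FirstReturn.
Context {R : realType} {T : countType}.
Variable p : T -> T -> \bar R.
Hypothesis p_ge0 : forall x y, 0 <= p x y.
Hypothesis p_sum1 : forall x, \esum_(y in [set: T]) p x y = 1.
Implicit Types (x y u v : T) (n : nat).

(* Probability that the chain started at [u] avoids [x] at times 1, ..., n. *)
Fixpoint avoid x n u : \bar R :=
  if n is n'.+1 then wsum (p u) (fun z => (z != x)%:R%:E * avoid x n' z) else 1.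

Lemma avoid_ge0 x n u : 0 <= avoid x n u.
Proof.
elim: n u => //= n IH u; apply: wsum_ge0 => // z.
by rewrite mule_ge0// lee_fin.
Qed.

Lemma avoidS x n u :
  avoid x n.+1 u = wsum (p u) (fun z => (z != x)%:R%:E * avoid x n z).
Proof. by []. Qed.

Let avoid_term_ge0 x n z : 0 <= (z != x)%:R%:E * avoid x n z.
Proof. by rewrite mule_ge0 ?avoid_ge0// lee_fin. Qed.

(** [first_return_prob] with the start freed from the target, as a recursion on the first step
    requires. *)
Definition hit_prob x n u : \bar R :=
  \esum_(r in [set r : seq T | (size r).+1 = n /\ x \notin r])
    path_prob p u (rcons r x).

Lemma path_prob_ge0 u s : 0 <= path_prob p u s.
Proof. by elim: s u => //= y s IH u; rewrite mule_ge0. Qed.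

Lemma hit_prob_ge0 x n u : 0 <= hit_prob x n u.
Proof. by apply: esum_ge0 => r _; exact: path_prob_ge0. Qed.

Lemma hit_prob0 x u : hit_prob x 0 u = 0.
Proof. by rewrite /hit_prob esum1// => r [/= ]. Qed.

Lemma hit_prob1 x u : hit_prob x 1 u = p u x.
Proof.
rewrite /hit_prob (_ : [set _ | _] = [set [::]]).
  by rewrite esum_set1 /= mule1.
by apply/seteqP; split => [[|? ?] [//= []]|_ ->].
Qed.

Lemma hit_probSS x n u :
  hit_prob x n.+2 u = wsum (p u) (fun z => (z != x)%:R%:E * hit_prob x n.+1 z).
Proof.
rewrite /hit_prob; pose D := [set r : seq T | (size r).+1 = n.+1 /\ x \notin r].
rewrite (@reindex_esum R _ _ ([set z | z != x] `*`` fun=> D) _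
    (fun k => k.1 :: k.2)); last first.
  split=> [[z r] [/= zx [[rn] xr]]|[z r] [z' r'] _ _ [-> ->]//|[|z r]] /=.
  - by rewrite rn inE negb_or eq_sym zx.
  - by case.
  - rewrite inE negb_or eq_sym => -[[rn] /andP[zx xr]].
    by exists (z, r) => //; split => //; rewrite /D /= rn.
rewrite -(esum_esum (a := fun z r => p u z * path_prob p z (rcons r x))); last first.
  by move=> z r _ _; rewrite mule_ge0 ?path_prob_ge0.
rewrite esum_mkcond; apply: eq_esum => z _.
have [zx|/negP zx] := boolP (z != x).
  by rewrite mem_set// mul1e esumZl// => r; exact: path_prob_ge0.
by rewrite memNset// mul0e mule0.
Qed.

Lemma avoid1 x u : avoid x 1 u = wsum (p u) (fun z => (z != x)%:R%:E).
Proof. by apply: eq_wsum => z; rewrite mule1. Qed.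

(** Makes the sums over hitting times telescope; the additive form avoids subtraction in the
    extended reals. *)
Lemma hit_avoid x n u : hit_prob x n.+1 u + avoid x n.+1 u = avoid x n u.
Proof.
have ind0 (b : bool) : 0 <= (b%:R : R)%:E by rewrite lee_fin.
elim: n u => [|n IH] u.
  rewrite hit_prob1 avoid1 -(wsum_pred1 x (p_ge0 u)) -wsumD//.
  rewrite -[RHS](@wsum_cst _ _ (p u))//; apply: eq_wsum => z.
  by rewrite -EFinD; case: (z == x); rewrite /= ?addr0 ?add0r.
rewrite hit_probSS (avoidS x n.+1) -wsumD//; last first.
  by move=> z; rewrite mule_ge0 ?hit_prob_ge0 ?lee_fin.
rewrite [RHS]avoidS; apply: eq_wsum => z.
rewrite -ge0_muleDr ?hit_prob_ge0 ?avoid_ge0//.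
by rewrite -IH.
Qed.

Lemma avoid_le1 x n u : avoid x n u <= 1.
Proof.
elim: n => // n; apply: le_trans.
by rewrite -(hit_avoid x n u) leeDr// hit_prob_ge0.
Qed.

Lemma avoid_fin x n u : avoid x n u \is a fin_num.
Proof.
by rewrite ge0_fin_numE ?avoid_ge0//; apply: le_lt_trans (avoid_le1 _ _ _) (ltry _).
Qed.

(* Decomposition according to the last visit to [x] in the time window 0..n. *)
Lemma last_visit x n u :
  \sum_(k < n.+1) nstep p k u x * avoid x (n - k) x +
    (u != x)%:R%:E * avoid x n u = 1.
Proof.
have s0 m z : 0 <= \sum_(k < m.+1) nstep p k z x * avoid x (m - k) x.
  by apply: sume_ge0 => k _; rewrite mule_ge0 ?avoid_ge0//; exact: nstep_ge0.
elim: n u => [|n IH] u.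
  by rewrite big_ord1 /= !mule1 -EFinD; case: (u == x); rewrite /= ?addr0 ?add0r.
rewrite big_ord_recl subn0 (eq_bigr (fun k : 'I_n.+1 =>
    wsum (p u) (fun z => nstep p k z x * avoid x (n - k) x))); last first.
  move=> k _; rewrite /= /wsum muleC -esumZl ?avoid_ge0//; last first.
    by move=> z; rewrite mule_ge0//; exact: nstep_ge0.
  by apply: eq_esum => z _; rewrite /= subSS muleC muleA.
rewrite -wsum_sum//; last first.
  by move=> k z; rewrite mule_ge0 ?avoid_ge0//; exact: nstep_ge0.
(* At time 0 the visit forces [u = x], so this term completes the one for [u != x] to the full
   probability of avoidance. *)
have -> : nstep p (@ord0 n.+1) u x * avoid x n.+1 x =
          (u == x)%:R%:E * avoid x n.+1 u.
  by rewrite /=; case: eqP => [->|]; rewrite ?mul0e.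
rewrite addeAC -ge0_muleDl ?lee_fin//.
have -> : (((u == x)%:R)%:E + ((u != x)%:R)%:E = 1 :> \bar R).
  by rewrite -EFinD; case: (u == x); rewrite /= ?addr0 ?add0r.
rewrite mul1e avoidS -wsumD//; last by move=> z; exact: s0.
by rewrite -[RHS](@wsum_cst _ _ (p u))//; apply: eq_wsum => z; rewrite addeC; exact: IH.
Qed.

(** Averaging [last_visit] over a stationary start turns every [nstep p k z x] into [pi x]; the term
    without a visit is dropped. *)
Lemma sum_avoid_le x n (pi : T -> R) : stationary_distribution p pi ->
  (pi x)%:E * \sum_(k < n.+1) avoid x k x <= 1.
Proof.
move=> st; have [pi0 pi1 _] := st.
have pi0' z : 0 <= (EFin \o pi) z by rewrite lee_fin.
have nn k z : 0 <= nstep p k z x by exact: nstep_ge0.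
have <- : \sum_(k < n.+1) avoid x (n - k) x = \sum_(k < n.+1) avoid x k x.
  rewrite (reindex_inj rev_ord_inj) /=; apply: eq_bigr => k _.
  by rewrite subSS subKn// -ltnS.
rewrite -[leRHS](@wsum_cst _ _ (EFin \o pi))//.
have -> : (pi x)%:E * \sum_(k < n.+1) avoid x (n - k) x =
    wsum (EFin \o pi) (fun z => \sum_(k < n.+1) nstep p k z x * avoid x (n - k) x).
  rewrite wsum_sum//; last by move=> k z; rewrite mule_ge0 ?avoid_ge0.
  rewrite ge0_sume_distrr; last by move=> k _; exact: avoid_ge0.
  apply: eq_bigr => k _; rewrite -(stationary_nstep p_ge0 k x st) muleC.
  rewrite -wsumZ ?avoid_ge0//.
  by apply: eq_wsum => z; rewrite muleC.
apply: le_wsum => // z; rewrite -(last_visit x n z) leeDl//.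
Qed.

Lemma positive_recurrent_of_stationary (pi : T -> R) :
  stationary_distribution p pi -> (forall x, (0 < pi x)%R) ->
  positive_recurrent_chain p.
Proof.
move=> st pi_gt0 x.
have first_hit n : first_return_prob p x n = hit_prob x n x by [].
have f0 n : 0 <= first_return_prob p x n by exact: hit_prob_ge0.
pose q n : R := fine (avoid x n x).
have qE n : avoid x n x = (q n)%:E by rewrite fineK// avoid_fin.
have q_le n : (\sum_(k < n.+1) q k <= (pi x)^-1)%R.
  rewrite -[leRHS]mul1r ler_pdivlMr// mulrC -lee_fin EFinM -sumEFin.
  by rewrite (eq_bigr (fun k : 'I_n.+1 => avoid x k x)) ?sum_avoid_le.
have q0 n : (0 <= q n)%R by rewrite fine_ge0 ?avoid_ge0.
have q_noninc n m : (n <= m)%N -> (q m <= q n)%R.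
  move=> /subnK <-; elim: (m - n)%N => // k; apply: le_trans.
  by rewrite addSn -lee_fin -!qE -(hit_avoid x (k + n) x) leeDr// hit_prob_ge0.
(* Monotone with bounded partial sums, [q] decays at least like 1/n; hence the return is almost
   sure. *)
have nq n : (n%:R * q n <= (pi x)^-1)%R.
  case: n => [|n]; first by rewrite mul0r invr_ge0 ltW.
  apply: le_trans (q_le n); rewrite mulr_natl -[X in (_ *+ X <= _)%R]card_ord.
  by rewrite -sumr_const; apply: ler_sum => k _; apply: q_noninc; exact: ltnW.
have part n : \sum_(0 <= k < n.+1) first_return_prob p x k + (q n)%:E = 1.
  elim: n => [|n IH].
    by rewrite big_nat1 first_hit hit_prob0 add0e -qE.
  by rewrite big_nat_recr//= first_hit -addeA -!qE hit_avoid qE IH.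
(* Summation by parts: the truncated mean return time plus [n * q n] is the sum of the tails. *)
have npart n : \sum_(0 <= k < n.+1) k%:R%:E * first_return_prob p x k +
    (n%:R * q n)%:E = (\sum_(k < n) q k)%:E.
  elim: n => [|n IH].
    by rewrite big_nat1 big_ord0 first_hit hit_prob0 mule0 mul0r adde0.
  rewrite big_nat_recr//= -addeA EFinM -ge0_muleDr ?hit_prob_ge0 ?lee_fin//.
  rewrite first_hit -qE hit_avoid qE big_ord_recr/= EFinD -IH -addeA -EFinM -EFinD.
  by congr (_ + _%:E); rewrite -natr1 mulrDl mul1r.
split.
  apply/eqP; rewrite eq_le; apply/andP; split.
    apply: lime_le; first exact: is_cvg_nneseries.
    apply: nearW => -[|n]; first by rewrite big_geq.
    by rewrite -(part n) leeDl// lee_fin.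
  apply/lee_addgt0Pr => e e0.
  pose n := Num.bound (((pi x)^-1) / e).
  have nP : ((pi x)^-1 / e < n%:R)%R.
    by apply: archi_boundP; rewrite divr_ge0 ?invr_ge0// ltW.
  have qe : (q n <= e)%R.
    rewrite leNgt; apply/negP => eq.
    have := nq n; rewrite leNgt => /negP; apply.
    rewrite ltr_pdivrMr// in nP; apply: lt_le_trans nP _.
    by rewrite ler_wpM2l// ltW.
  rewrite -(part n); apply: leeD; last by rewrite lee_fin.
  exact: nneseries_lim_ge.
apply: le_lt_trans (ltry ((pi x)^-1)).
have h0 k : 0 <= k%:R%:E * first_return_prob p x k by rewrite mule_ge0 ?lee_fin.
apply: lime_le; first exact: is_cvg_nneseries.
apply: nearW => -[|n]; first by rewrite big_geq// lee_fin invr_ge0 ltW.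
apply: le_trans (_ : _ <= (\sum_(k < n) q k)%:E) _.
  by rewrite -npart leeDl// lee_fin mulr_ge0.
rewrite lee_fin; apply: le_trans (q_le n).
by rewrite [leRHS]big_ord_recr/= lerDl.
Qed.

End FirstReturn.

(** * A Harris-type ergodic theorem on a countable space *)

Section ErgodicTheorem.
Context {R : realType} {T : countType}.
Variable p : T -> T -> \bar R.
Hypothesis p_ge0 : forall x y, 0 <= p x y.
Hypothesis p_sum1 : forall x, \esum_(y in [set: T]) p x y = 1.

(** Some state carries mass, and irreducibility transports part of it to any [x]. *)
Lemma stationary_gt0 (pi : T -> R) : irreducible_chain p ->
  stationary_distribution p pi -> forall x, (0 < pi x)%R.
Proof.
move=> irr st x; have [pi0 pi1 _] := st.
have [u piu] : exists u, (0 < pi u)%R.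
  apply: contrapT => /forallNP h; move: pi1.
  rewrite esum1 => [/eqP|u _]; first by rewrite eqe eq_sym oner_eq0.
  by apply/eqP; rewrite eqe eq_le pi0 andbT leNgt; apply/negP.
have [n pn] := irr u x.
rewrite -lte_fin -(stationary_nstep p_ge0 n x st).
apply: lt_le_trans (_ : 0 < (pi u)%:E * nstep p n u x) _.
  by rewrite mule_gt0 ?lte_fin.
apply: (le_esum_term (a := fun v => (pi v)%:E * nstep p n v x)) => // v.
by rewrite mule_ge0 ?lee_fin//; exact: nstep_ge0.
Qed.

Theorem ergodic_of_drift (V : T -> nat) (g K : R) (o : T) (a : nat -> R) :
    (0 <= g < 1)%R -> (0 <= K)%R -> (forall n, 0 < a n)%R ->
    (forall u, wsum (p u) (fun z => (V z)%:R%:E) <= (g * (V u)%:R + K)%:E) ->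
    (forall n u, (V u <= n)%N -> (a n)%:E <= p u o) ->
    irreducible_chain p ->
  positive_recurrent_chain p /\ exists pi : T -> R,
    [/\ stationary_distribution p pi,
        forall pi', stationary_distribution p pi' -> pi' = pi &
        forall nu : T -> \bar R, (forall v, 0 <= nu v) ->
          \esum_(v in [set: T]) nu v = 1 -> forall y,
          wsum nu (fun v => nstep p n v y) @[n --> \oo] --> (pi y)%:E].
Proof.
move=> g01 K0 a0 drift minor irr.
have [rho [B [rho01 B0 erg]]] :=
  geometric_ergodicity p_ge0 p_sum1 g01 K0 a0 drift minor.
have [pi [st piP]] := limit_law p_ge0 p_sum1 o rho01 B0 erg.
have cvgnu nu y : (forall v, 0 <= nu v) -> \esum_(v in [set: T]) nu v = 1 ->
    wsum nu (fun v => nstep p n v y) @[n --> \oo] --> (pi y)%:E.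
  move=> nu0 nu1; apply: (initial_law_cvg p_ge0 p_sum1 o rho01 B0) => //.
  by case: st.
split.
  by apply: (positive_recurrent_of_stationary p_ge0 p_sum1 st); exact: stationary_gt0.
exists pi; split => // [pi' st'|nu nu0 nu1 y]; last exact: cvgnu.
have [pi'0 pi'1 _] := st'; apply/funext => y.
(* Started from [pi'] the law never changes, yet it converges to [pi]. *)
have : wsum (EFin \o pi') (fun v => nstep p n v y) @[n --> \oo] --> (pi y)%:E.
  by apply: cvgnu => // v; rewrite lee_fin.
rewrite (_ : (fun n => _) = fun=> (pi' y)%:E); last first.
  by apply/funext => n; exact: stationary_nstep.
by move=> /(cvg_unique (@ereal_hausdorff R) (cvg_cst _)) [].
Qed.

End ErgodicTheorem.

(** * Marginals of a Markov chain with an arbitrary initial law *)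

Section MarkovChainLaw.
Context {R : realType} {T : countType} {d : measure_display}
  {Omega : measurableType d}.

Lemma measure_countable_partition (mu : {measure set Omega -> \bar R})
    (Y : Omega -> T) (A : set Omega) :
    measurable A -> (forall z, measurable (Y @^-1` [set z])) ->
  mu A = \esum_(z in [set: T]) mu (A `&` Y @^-1` [set z]).
Proof.
move=> mA mY.
(* Countable additivity concerns sequences: pieces are indexed by codes, and a number coding no
   state gets the empty set. *)
pose F n := if @pickle_inv T n is Some z then A `&` Y @^-1` [set z] else set0.
have mF n : measurable (F n).
  by rewrite /F; case: pickle_inv => [z|//]; exact: measurableI.
have AE : A = \bigcup_n F n.
  apply/seteqP; split => [w Aw|w [n _]].
    by exists (pickle (Y w)) => //; rewrite /F pickleK_inv.
  by rewrite /F; case: pickle_inv => // z [].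
rewrite [in LHS]AE measure_bigcup//; last first.
  apply/trivIsetP => i j _ _ ij; rewrite /F.
  have := @pickle_invK T i; have := @pickle_invK T j.
  case: pickle_inv => [z|]; case: pickle_inv => [z'|] /=; rewrite ?setI0 ?set0I//.
  move=> zi zj; apply/seteqP; split => // w [[_ /= wz] [_ /= wz']].
  by move/eqP: ij; apply; rewrite -zi -zj -wz -wz'.
rewrite nneseries_esum//.
have -> : [set x | (x \in [set: nat]) = true] = [set: nat].
  by apply/seteqP; split => // n _ /=; rewrite mem_set.
rewrite (eq_esum (b := fun n =>
    if n \in range (@pickle T) then mu (F n) else 0)); last first.
  move=> n _; case: ifPn => // /negP nr; rewrite /F.
  have := @pickle_invK T n; case: pickle_inv => [z /= zn|_]; last by rewrite measure0.
  by case: nr; rewrite inE; exists z.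
rewrite -esum_mkcond esum_image; last by move=> z z' _ _; exact: pcan_inj (@pickleK_inv T) _ _.
by apply: eq_esum => z _; rewrite /F pickleK_inv.
Qed.

Variable p : T -> T -> \bar R.
Hypothesis p_ge0 : forall x y, 0 <= p x y.
Variables (P : probability Omega R) (X : nat -> Omega -> T).
Hypothesis X_markov : is_markov_chain p P X.

Let measurable_path t (h : nat -> T) :
  measurable [set w | forall r, (r <= t)%N -> X r w = h r].
Proof.
have [mX _] := X_markov.
rewrite (_ : [set _ | _] = \bigcap_(r in [set r | (r <= t)%N]) X r @^-1` [set h r]).
  by apply: bigcap_measurable => [|r _]; [exists 0%N|exact: mX].
by apply/seteqP; split => w /= wP r; exact: wP.
Qed.

(** [is_markov_chain] only extends a full history by one step, so the induction on [n] varies [t]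
    and [h]: the value at time [t.+1] is summed over and appended to the history. *)
Lemma markov_path_nstep n t (h : nat -> T) y :
  P [set w | (forall r, (r <= t)%N -> X r w = h r) /\ X (t + n)%N w = y] =
  P [set w | forall r, (r <= t)%N -> X r w = h r] * nstep p n (h t) y.
Proof.
have [mX XP] := X_markov.
elim: n t h => [|n IH] t h /=.
  case: eqP => [<-|hty].
    rewrite mule1; congr (P _); apply/seteqP; split => w /=; first by case.
    by move=> wP; split => //; rewrite addn0 wP.
  rewrite mule0 -[RHS](measure0 P); congr (P _); apply/seteqP; split => // w /=.
  by rewrite addn0 => -[wh wy]; apply: hty; rewrite -wy wh.
rewrite (@measure_countable_partition P (X t.+1)); first last.
- by move=> z; exact: mX.
- rewrite (_ : [set _ | _] = [set w | forall r, (r <= t)%N -> X r w = h r] `&`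
      X (t + n.+1)%N @^-1` [set y]); last by apply/seteqP; split => w /= [].
  by apply: measurableI => //; exact: mX.
rewrite -esumZl//; last by move=> z; rewrite mule_ge0//; exact: nstep_ge0.
apply: eq_esum => z _.
pose h' r := if r == t.+1 then z else h r.
have h't : h' t.+1 = z by rewrite /h' eqxx.
have h'le r : (r <= t)%N -> h' r = h r.
  by move=> rt; rewrite /h'; case: eqP => // rE; rewrite rE ltnn in rt.
have -> : [set w | (forall r, (r <= t)%N -> X r w = h r) /\
      X (t + n.+1)%N w = y] `&` X t.+1 @^-1` [set z] =
    [set w | (forall r, (r <= t.+1)%N -> X r w = h' r) /\ X (t.+1 + n)%N w = y].
  rewrite addSnnS; apply/seteqP; split => w /=.
    move=> [[wh wy] wz]; split => // r.
    by rewrite leq_eqVlt => /predU1P[->|rt]; rewrite ?h't// h'le// wh.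
  move=> [wh wy]; split; last by rewrite wh// h't.
  by split => // r rt; rewrite wh ?h'le// ltnW.
apply: (etrans (IH t.+1 h')); rewrite (XP t h') h't h'le// muleA; congr (P _ * _ * _).
by apply/seteqP; split => w /= wh r rt; rewrite wh// h'le.
Qed.

Lemma markov_marginal n y : P [set w | X n w = y] =
  wsum (fun v => P [set w | X 0%N w = v]) (fun v => nstep p n v y).
Proof.
have [mX _] := X_markov.
rewrite (@measure_countable_partition P (X 0%N)); [|exact: mX|by move=> z; exact: mX].
apply: eq_esum => v _; have := markov_path_nstep n 0 (fun=> v) y.
have -> : [set w | forall r, (r <= 0)%N -> X r w = v] = [set w | X 0%N w = v].
  apply/seteqP; split => w /= wv; first exact: wv.
  by move=> r; rewrite leqn0 => /eqP ->.
move=> <-; congr (P _); apply/seteqP; split => w /= [].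
  by move=> wy wv; split => // r; rewrite leqn0 => /eqP ->.
by move=> wv wy; split => //; exact: wv.
Qed.

Lemma initial_law_sum1 : \esum_(v in [set: T]) P [set w | X 0%N w = v] = 1.
Proof.
have [mX _] := X_markov; rewrite -(probability_setT P).
rewrite (@measure_countable_partition P (X 0%N))//.
by apply: eq_esum => v _; rewrite setTI.
Qed.

End MarkovChainLaw.

(** * Product weights on finite families: independence across levels *)

Section FfunSum.
Context {R : realType} {X : countType}.

Definition ffun_cons n (k : X * {ffun 'I_n -> X}) : {ffun 'I_n.+1 -> X} :=
  [ffun i => if unlift ord0 i is Some j then k.2 j else k.1].

Lemma ffun_cons_bij n : set_bij setT setT (@ffun_cons n).
Proof.
split => // [[x f] [x' f'] _ _ /ffunP E|f _].
  congr pair; first by have := E ord0; rewrite !ffunE unlift_none.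
  by apply/ffunP => i; have := E (lift ord0 i); rewrite !ffunE liftK.
exists (f ord0, [ffun i => f (lift ord0 i)]) => //.
by apply/ffunP => i; rewrite ffunE; case: unliftP => [j ->|->] //=; rewrite ffunE.
Qed.

Lemma esum_ffun_prod n (F : 'I_n -> X -> R) (s : 'I_n -> R) :
    (forall i x, (0 <= F i x)%R) ->
    (forall i, \esum_(x in [set: X]) (F i x)%:E = (s i)%:E) ->
  \esum_(f in [set: {ffun 'I_n -> X}]) ((\prod_(i < n) F i (f i))%R)%:E =
  ((\prod_(i < n) s i)%R)%:E.
Proof.
elim: n F s => [|n IH] F s F0 Fs.
  pose f0 : {ffun 'I_0 -> X} := ffun0 (card_ord 0).
  rewrite (_ : [set: _] = [set f0]).
    by rewrite esum_set1 ?big_ord0// lee_fin ler01.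
  by apply/seteqP; split => // f _; apply/ffunP => -[].
rewrite (@reindex_esum _ _ _ _ _ _ _ (@ffun_cons_bij n)) esum_prod; last first.
  by move=> k; rewrite lee_fin prodr_ge0.
rewrite big_ord_recl EFinM -Fs muleC -esumZl; first last.
- by move=> x; rewrite lee_fin.
- rewrite lee_fin prodr_ge0// => i _; rewrite -lee_fin -Fs.
  by apply: esum_ge0 => x _; rewrite lee_fin.
apply: eq_esum => x _.
rewrite muleC -(IH (fun i => F (lift ord0 i))) => [|i y|i] //.
rewrite -esumZl ?lee_fin//; last by move=> f; rewrite lee_fin prodr_ge0.
apply: eq_esum => f _; rewrite big_ord_recl -EFinM ffunE unlift_none.
by congr (_ * _)%:E; apply: eq_bigr => i _; rewrite ffunE liftK.
Qed.

Lemma esum_ffun_prod1 n (F : 'I_n -> X -> R) :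
    (forall i x, (0 <= F i x)%R) ->
    (forall i, \esum_(x in [set: X]) (F i x)%:E = 1) ->
  \esum_(f in [set: {ffun 'I_n -> X}]) ((\prod_(i < n) F i (f i))%R)%:E = 1.
Proof.
move=> F0 F1; rewrite (@esum_ffun_prod n F (fun=> 1%R))//.
by rewrite big1.
Qed.

Lemma ffun_prod_mean n (F : 'I_n -> X -> R) (g : X -> R) (m : 'I_n -> R) :
    (forall i x, (0 <= F i x)%R) ->
    (forall i, \esum_(x in [set: X]) (F i x)%:E = 1) ->
    (forall x, (0 <= g x)%R) ->
    (forall i, wsum (EFin \o F i) (EFin \o g) = (m i)%:E) ->
  wsum (fun f : {ffun 'I_n -> X} => ((\prod_(i < n) F i (f i))%R)%:E)
    (fun f => ((\sum_(i < n) g (f i))%R)%:E) = ((\sum_(i < n) m i)%R)%:E.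
Proof.
move=> F0 F1 g0 gm.
have P0 (f : {ffun 'I_n -> X}) : 0 <= ((\prod_(i < n) F i (f i))%R)%:E.
  by rewrite lee_fin prodr_ge0.
under eq_wsum do rewrite -sumEFin.
rewrite wsum_sum//; last by move=> i f; rewrite lee_fin.
rewrite -sumEFin; apply: eq_bigr => j _.
(* [g] is absorbed into the factor of coordinate [j] alone; every other coordinate still sums to
   1. *)
pose h i x : R := if i == j then g x else 1%R.
rewrite /wsum (eq_esum (b := fun f : {ffun 'I_n -> X} =>
    ((\prod_(i < n) (F i (f i) * h i (f i)))%R)%:E)); last first.
  move=> f _; rewrite -EFinM big_split/=; congr (_ * _)%:E.
  rewrite (bigD1 j)//= /h eqxx big1 ?mulr1// => i ij.
  by rewrite (negbTE ij).
rewrite (@esum_ffun_prod n (fun i x => F i x * h i x)%R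
    (fun i => if i == j then m j else 1%R)).
- rewrite (bigD1 j)//= eqxx big1 ?mulr1// => i ij.
  by rewrite (negbTE ij).
- by move=> i x; rewrite /h; case: eqP => _; rewrite mulr_ge0.
- move=> i; rewrite /h; case: eqP => [->|_]; first by rewrite -gm.
  by rewrite -(F1 i); apply: eq_esum => x _; rewrite mulr1.
Qed.

End FfunSum.

(** * Poisson and binomial laws, and the actions of the traders at a level *)

Section Laws.
Context {R : realType}.

Lemma poisson_pmf_sum1 (L : R) : (0 < L)%R ->
  \esum_(k in [set: nat]) (poisson_pmf L k)%:E = 1.
Proof.
move=> L0; have : poisson_prob L 0 [set: nat] = 1 := probability_setT _.
by rewrite /poisson_prob L0.
Qed.

Lemma binomial_pmf_sum1 n (q : R) : (0 <= q <= 1)%R ->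
  \esum_(k in [set: nat]) (binomial_pmf n q k)%:E = 1.
Proof.
move=> q01; have : binomial_prob n q [set: nat] = 1 := probability_setT _.
by rewrite /binomial_prob q01.
Qed.

Lemma poisson_mean (L : R) : (0 < L)%R ->
  wsum (fun k => (poisson_pmf L k)%:E) (fun k => k%:R%:E) = L%:E.
Proof.
move=> L0; rewrite /wsum -[RHS]mule1 -(poisson_pmf_sum1 L0) -esumZl; first last.
- by move=> k; rewrite lee_fin poisson_pmf_ge0.
- by rewrite lee_fin ltW.
(* The term at 0 vanishes, and [k.+1] times the mass at [k.+1] is [L] times the mass at [k]. *)
rewrite [LHS](eq_esum (b := fun k => if k \in [set k | k != 0%N] then
    (poisson_pmf L k)%:E * k%:R%:E else 0)); last first.
  by move=> [|k] _; [rewrite mule0 if_same|rewrite mem_set].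
rewrite -esum_mkcond (@reindex_esum R _ _ [set: nat] _ S); last first.
  by split => // [? ? _ _ []//|[|k] // _]; exists k.
apply: eq_esum => k _; rewrite -!EFinM /poisson_pmf L0; congr (_%:E).
rewrite exprS factS natrM invfM.
by field; rewrite nat1r !pnatr_eq0 -lt0n fact_gt0.
Qed.

Lemma esum_action (a : action -> \bar R) : (forall z, 0 <= a z) ->
  \esum_(z in [set: action]) a z = a Quit + a Move + a Stay.
Proof.
move=> a0; rewrite (eq_esum (b := fun z =>
    \sum_(y <- [:: Quit; Move; Stay]) (a z * (z == y)%:R%:E))); last first.
  by move=> z _; rewrite !big_cons big_nil; case: z; rewrite ?mule1 ?mule0 ?adde0 ?add0e.
rewrite esum_sum; last by move=> z y _ _; rewrite mule_ge0 ?lee_fin.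
rewrite (eq_bigr a); last by move=> y _; exact: esum_pred1.
by rewrite !big_cons big_nil adde0 addeA.
Qed.

Variables pQ pM : R.
Hypotheses (pQ0 : (0 <= pQ)%R) (pM0 : (0 <= pM)%R) (pQM : (pQ + pM <= 1)%R).

Lemma action_prob_ge0 a : (0 <= action_prob pQ pM a)%R.
Proof.
by case: a => //=; rewrite -addrA -opprD subr_ge0.
Qed.

Lemma actions_prob_ge0 k s : (0 <= actions_prob pQ pM k s)%R.
Proof.
by rewrite /actions_prob; case: ifP => // _; apply: prodr_ge0 => a _; exact: action_prob_ge0.
Qed.

Lemma wsum_actionsS k (F : seq action -> \bar R) : (forall s, 0 <= F s) ->
  wsum (fun s => (actions_prob pQ pM k.+1 s)%:E) F =
  \esum_(a in [set: action]) ((action_prob pQ pM a)%:E *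
    wsum (fun s => (actions_prob pQ pM k s)%:E) (fun s => F (a :: s))).
Proof.
move=> F0; rewrite /wsum (eq_esum (b := fun s => if s \in [set s | s != [::]] then
    (actions_prob pQ pM k.+1 s)%:E * F s else 0)); last first.
  move=> [|a s] _; first by rewrite memNset//= /actions_prob /= mul0e.
  by rewrite mem_set.
rewrite -esum_mkcond (@reindex_esum R _ _ [set: action * seq action] _
    (fun k => k.1 :: k.2)); last first.
  by split => // [[a s] [a' s'] _ _ [-> ->]//|[|a s]//= _]; exists (a, s).
rewrite esum_prod; last by move=> z; rewrite mule_ge0 ?lee_fin ?actions_prob_ge0.
apply: eq_esum => a _; rewrite -esumZl ?lee_fin ?action_prob_ge0//; last first.
  by move=> s; rewrite mule_ge0 ?lee_fin ?actions_prob_ge0.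
apply: eq_esum => s _; rewrite muleA -EFinM /actions_prob /= eqSS big_cons.
by case: ifP => // _; rewrite mulr0.
Qed.

Lemma actions_prob_sum1 k :
  \esum_(s in [set: seq action]) (actions_prob pQ pM k s)%:E = 1.
Proof.
rewrite (eq_esum (b := fun s => (actions_prob pQ pM k s)%:E * 1)); last first.
  by move=> s _; rewrite mule1.
rewrite -/(wsum _ (fun=> 1)); elim: k => [|k IH].
  rewrite /wsum (eq_esum (b := fun s : seq action => 1 * (s == [::])%:R%:E)).
    by rewrite (@esum_pred1 R _ _ (fun=> 1)).
  move=> [|a s] _ /=; first by rewrite /actions_prob /= big_nil.
  by rewrite /actions_prob /= mul0e mule0.
rewrite wsum_actionsS// IH esum_action; last first.
  by move=> a; rewrite mule1 lee_fin action_prob_ge0.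
by rewrite !mule1 -!EFinD /=; congr (_%:E); ring.
Qed.

(** Traders who do not quit. Moves off the end of the grid are included, so that the mean is exact
    and independent of the level; this overcounts the next book. *)
Definition staying (s : seq action) : nat :=
  (count_mem Stay s + count_mem Move s)%N.

Lemma actions_prob_mean k :
  wsum (fun s => (actions_prob pQ pM k s)%:E) (fun s => (staying s)%:R%:E) =
  ((1 - pQ) * k%:R)%:E.
Proof.
have w0 j s : 0 <= (actions_prob pQ pM j s)%:E.
  by rewrite lee_fin actions_prob_ge0.
elim: k => [|k IH].
  rewrite mulr0 /wsum esum1// => -[|a s] _ /=; first by rewrite mule0.
  by rewrite /actions_prob /= mul0e.
have step (c : nat) : wsum (fun s => (actions_prob pQ pM k s)%:E)
    (fun s => (c + staying s)%:R%:E) = (c%:R + (1 - pQ) * k%:R)%:E.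
  under eq_wsum do rewrite natrD EFinD.
  rewrite wsumD//; [|by move=> z; rewrite lee_fin..].
  by rewrite IH wsum_cst ?lee_fin ?actions_prob_sum1// EFinD.
rewrite wsum_actionsS//.
rewrite esum_action; last first.
  move=> a; rewrite mule_ge0 ?lee_fin ?action_prob_ge0//.
  by apply: wsum_ge0 => // s; rewrite lee_fin.
have stepa a (c : nat) : (forall s, staying (a :: s) = (c + staying s)%N) ->
    wsum (fun s => (actions_prob pQ pM k s)%:E)
      (fun s => (staying (a :: s))%:R%:E) = (c%:R + (1 - pQ) * k%:R)%:E.
  by move=> E; rewrite -step; apply: eq_wsum => s; rewrite E.
rewrite (stepa Quit 0%N)// (stepa Move 1%N); last first.
  by move=> s; rewrite /staying /= add0n addnCA.
rewrite (stepa Stay 1%N); last by move=> s; rewrite /staying /= add0n addnA.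
rewrite -!EFinM -!EFinD /=; congr (_%:E).
by rewrite -natr1; ring.
Qed.

Lemma actions_prob_nseq k a :
  actions_prob pQ pM k (nseq k a) = (action_prob pQ pM a ^+ k)%R.
Proof. by rewrite /actions_prob size_nseq eqxx big_nseq iter_mulr_1. Qed.

End Laws.

(** Movers from one level reach at most one level, so summing over destinations counts them at most
    once; movers off the grid are lost. *)
Lemma sum_sum_injective_le (I J : finType) (r : I -> J -> bool) (c : I -> nat) :
    (forall i j j', r i j -> r i j' -> j = j') ->
  (\sum_j \sum_(i | r i j) c i <= \sum_i c i)%N.
Proof.
move=> inj; rewrite (exchange_big_dep xpredT)//=; apply: leq_sum => i _.
have [j rij|none] := pickP (r i).
  by rewrite (big_pred1 j)// => j' /=; apply/idP/eqP => [rij'|->//]; exact: (inj i).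
by rewrite big1// => j; rewrite none.
Qed.

Lemma wsum_shift (R : realType) (T : countType) (w f : T -> \bar R) (c : R) :
    (forall z, 0 <= w z) -> (forall z, 0 <= f z) ->
    \esum_(z in [set: T]) w z = 1 -> (0 <= c)%R ->
  wsum w (fun z => c%:E + f z) = c%:E + wsum w f.
Proof. by move=> w0 f0 w1 c0; rewrite wsumD// wsum_cst ?lee_fin. Qed.

(** * The limit order book: drift, emptying, irreducibility, aperiodicity *)

Section LobChain.
Context {R : realType} {N : nat}.
Variables (Lb Ls pT pQ pM : R).
Hypotheses (Lb0 : (0 < Lb)%R) (Ls0 : (0 < Ls)%R).
Hypotheses (pT01 : (0 < pT < 1)%R) (pQ01 : (0 < pQ < 1)%R)
  (pM01 : (0 < pM < 1)%R) (pQM : (pQ + pM < 1)%R).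

Local Notation out := (outcome_prob Lb Ls pT pQ pM).
Local Notation kernel := (@lob_kernel R N Lb Ls pT pQ pM).

Let pT01' : (0 <= pT <= 1)%R.
Proof. by case/andP: pT01 => ? ?; rewrite !ltW. Qed.

Let pQ0' : (0 <= pQ)%R.
Proof. by case/andP: pQ01 => /ltW. Qed.

Let pM0' : (0 <= pM)%R.
Proof. by case/andP: pM01 => /ltW. Qed.

Let pQM' : (pQ + pM <= 1)%R := ltW pQM.

Definition trades_weight (u : lob_state N) (n : {ffun 'I_N -> nat}) : R :=
  \prod_(i < N) binomial_pmf (minn (u.1 i) (u.2 i)) pT (n i).

Definition actions_weight (k : 'I_N -> nat) (m : {ffun 'I_N -> seq action}) : R :=
  \prod_(i < N) actions_prob pQ pM (k i) (m i).

Lemma outcome_probE u (n : {ffun 'I_N -> nat}) mb ms x y :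
  out u (n, mb, ms, x, y) =
  (trades_weight u n * actions_weight (fun i => u.1 i - n i)%N mb *
   actions_weight (fun i => u.2 i - n i)%N ms *
   poisson_pmf Lb x * poisson_pmf Ls y)%R.
Proof. by case: u => b s; rewrite /= !big_split. Qed.

Lemma trades_weight_ge0 u n : (0 <= trades_weight u n)%R.
Proof. by apply: prodr_ge0 => i _; exact: binomial_pmf_ge0. Qed.

Lemma actions_weight_ge0 k m : (0 <= actions_weight k m)%R.
Proof. by apply: prodr_ge0 => i _; exact: actions_prob_ge0. Qed.

Lemma outcome_prob_ge0 u (w : lob_outcome N) : (0 <= out u w)%R.
Proof.
move: w => [[[[n mb] ms] x] y]; rewrite outcome_probE !mulr_ge0//;
  by rewrite ?trades_weight_ge0 ?actions_weight_ge0 ?poisson_pmf_ge0.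
Qed.

Lemma trades_weight_sum1 u : \esum_(n in setT) (trades_weight u n)%:E = 1.
Proof.
apply: (@esum_ffun_prod1 _ _ _
  (fun i => binomial_pmf (minn (u.1 i) (u.2 i)) pT)) => [i k|i]; first exact: binomial_pmf_ge0.
exact: binomial_pmf_sum1.
Qed.

Lemma actions_weight_sum1 k : \esum_(m in setT) (actions_weight k m)%:E = 1.
Proof.
apply: (@esum_ffun_prod1 _ _ _
  (fun i => actions_prob pQ pM (k i))) => [i s|i]; first exact: actions_prob_ge0.
exact: actions_prob_sum1.
Qed.

Lemma actions_weight_mean k :
  wsum (fun m => (actions_weight k m)%:E)
    (fun m => (\sum_(i < N) (staying (m i))%:R)%R%:E) =
  (\sum_(i < N) (1 - pQ) * (k i)%:R)%R%:E.
Proof.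
apply: (@ffun_prod_mean _ _ _ (fun i => actions_prob pQ pM (k i))
  (fun s => (staying s)%:R%R)) => // [i s|i|i].
- exact: actions_prob_ge0.
- exact: actions_prob_sum1.
- exact: actions_prob_mean.
Qed.

(** The trades stand outermost because the numbers of traders left to act depend on them. *)
Lemma esum_outcome u (F : lob_outcome N -> \bar R) : (forall w, 0 <= F w) ->
  \esum_(w in setT) ((out u w)%:E * F w) =
  wsum (fun n => (trades_weight u n)%:E) (fun n =>
  wsum (fun mb => (actions_weight (fun i => u.1 i - n i)%N mb)%:E) (fun mb =>
  wsum (fun ms => (actions_weight (fun i => u.2 i - n i)%N ms)%:E) (fun ms =>
  wsum (fun x => (poisson_pmf Lb x)%:E) (fun x =>
  wsum (fun y => (poisson_pmf Ls y)%:E) (fun y => F (n, mb, ms, x, y)))))).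
Proof.
move=> F0.
have tw n := trades_weight_ge0 u n.
have aw k m := actions_weight_ge0 k m.
have P0 (L : R) k : (0 <= poisson_pmf L k)%R := poisson_pmf_ge0 L k.
have G0 w : 0 <= (out u w)%:E * F w by rewrite mule_ge0 ?lee_fin ?outcome_prob_ge0.
rewrite esum_prod// esum_prod; last by move=> ?; exact: esum_ge0.
rewrite esum_prod; last by move=> ?; apply: esum_ge0 => *; exact: esum_ge0.
rewrite esum_prod; last first.
  by move=> ?; apply: esum_ge0 => *; apply: esum_ge0 => *; exact: esum_ge0.
apply: eq_esum => n _; rewrite -esumZl ?lee_fin//; last first.
  move=> mb; rewrite mule_ge0 ?lee_fin//.
  by do 3 (apply: wsum_ge0 => [?|?]; rewrite ?lee_fin//).
apply: eq_esum => mb _.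
rewrite -esumZl ?lee_fin//; last first.
  by move=> ms; rewrite mule_ge0 ?lee_fin//;
    do 2 (apply: wsum_ge0 => [?|?]; rewrite ?lee_fin//).
rewrite -esumZl ?lee_fin//; last first.
  move=> ms; rewrite !mule_ge0 ?lee_fin//;
    by do 2 (apply: wsum_ge0 => [?|?]; rewrite ?lee_fin//).
apply: eq_esum => ms _.
rewrite muleA muleA -esumZl ?mule_ge0 ?lee_fin//; last first.
  move=> x; rewrite mule_ge0 ?lee_fin//.
  by apply: wsum_ge0 => [?|?]; rewrite ?lee_fin.
apply: eq_esum => x _; rewrite muleA -esumZl ?mule_ge0 ?lee_fin//; last first.
  by move=> y; rewrite mule_ge0 ?lee_fin.
by apply: eq_esum => y _; rewrite muleA -!EFinM outcome_probE.
Qed.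

Lemma wsum_kernel u (f : lob_state N -> \bar R) : (forall v, 0 <= f v) ->
  wsum (kernel u) f = \esum_(w in setT) ((out u w)%:E * f (lob_next w)).
Proof.
move=> f0; rewrite -(esum_fibre (@lob_next N)); last first.
  by move=> w; rewrite mule_ge0 ?lee_fin ?outcome_prob_ge0.
apply: eq_esum => v _; rewrite /lob_kernel muleC -esumZl//; last first.
  by move=> w; rewrite lee_fin outcome_prob_ge0.
by apply: eq_esum => w <-; rewrite muleC.
Qed.

Lemma kernel_ge0 u v : 0 <= kernel u v.
Proof. by apply: esum_ge0 => w _; rewrite lee_fin outcome_prob_ge0. Qed.

Lemma kernel_sum1 u : \esum_(v in setT) kernel u v = 1.
Proof.
rewrite (eq_esum (b := fun v => kernel u v * 1)); last by move=> v _; rewrite mule1.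
rewrite -/(wsum _ (fun=> 1)) wsum_kernel// esum_outcome//.
have tw n : 0 <= (trades_weight u n)%:E by rewrite lee_fin trades_weight_ge0.
have aw k m : 0 <= (actions_weight k m)%:E by rewrite lee_fin actions_weight_ge0.
rewrite -[RHS](@wsum_cst _ _ (fun n => (trades_weight u n)%:E))//; last exact: trades_weight_sum1.
apply: eq_wsum => n.
rewrite -[RHS](@wsum_cst _ _ (fun mb =>
  (actions_weight (fun i => u.1 i - n i)%N mb)%:E))// ?actions_weight_sum1//.
apply: eq_wsum => mb.
rewrite -[RHS](@wsum_cst _ _ (fun mb =>
  (actions_weight (fun i => u.2 i - n i)%N mb)%:E))// ?actions_weight_sum1//.
apply: eq_wsum => ms.
have P0 (L : R) k : 0 <= (poisson_pmf L k)%:E by rewrite lee_fin poisson_pmf_ge0.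
rewrite -[RHS](@wsum_cst _ _ (fun x => (poisson_pmf Lb x)%:E))// ?poisson_pmf_sum1//.
apply: eq_wsum => x.
by rewrite wsum_cst// poisson_pmf_sum1.
Qed.

Definition traders (u : lob_state N) : nat := (\sum_(i < N) (u.1 i + u.2 i))%N.

Lemma traders_next (n : {ffun 'I_N -> nat}) mb ms x y :
  (traders (lob_next (n, mb, ms, x, y)) <=
   \sum_(i < N) staying (mb i) + \sum_(i < N) staying (ms i) + x + y)%N.
Proof.
have single (r : pred 'I_N) z : (forall i i', r i -> r i' -> i = i') ->
    (\sum_(i < N) (if r i then z else 0) <= z)%N.
  move=> rr; rewrite -big_mkcond /=.
  have [i ri|none] := pickP r; last by rewrite big1// => i; rewrite none.
  by rewrite (big_pred1 i)// => i' /=; apply/idP/eqP => [ri'|->//]; exact: rr.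
have moveb := @sum_sum_injective_le _ _ (fun j i : 'I_N => j.+1 == i :> nat)
  (fun j => count_mem Move (mb j)).
have moves := @sum_sum_injective_le _ _ (fun j i : 'I_N => val j == i.+1 :> nat)
  (fun j => count_mem Move (ms j)).
have bx := single (fun i : 'I_N => val i == 0%N) x.
have sy := single (fun i : 'I_N => i.+1 == N) y.
rewrite /traders; under eq_bigr do rewrite !ffunE.
do 5 rewrite big_split /=.
rewrite /staying [in leqRHS]big_split [X in (_ <= _ + X + _ + _)%N]big_split /=.
have {}moveb : (\sum_(j < N) \sum_(i < N | i.+1 == j) count_mem Move (mb i) <=
    \sum_(i < N) count_mem Move (mb i))%N.
  by apply: moveb => i j j' /eqP ij /eqP ij'; apply: val_inj; rewrite /= -ij -ij'.
have {}moves : (\sum_(j < N) \sum_(i < N | i == j.+1 :> nat) count_mem Move (ms i) <=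
    \sum_(i < N) count_mem Move (ms i))%N.
  apply: moves => i j j' /eqP ij /eqP ij'; apply: val_inj.
  by move: ij; rewrite ij' => -[].
have {}bx : (\sum_(i < N) (if i == 0%N :> nat then x else 0) <= x)%N.
  by apply: bx => i i' /eqP ii /eqP ii'; apply: val_inj; rewrite /= ii ii'.
have {}sy : (\sum_(i < N) (if i.+1 == N then y else 0) <= y)%N.
  apply: sy => i i' /eqP ii /eqP; rewrite -[in RHS]ii => -[ii'].
  exact/esym/val_inj.
apply: leq_trans (leq_add (leq_add (leq_add (leqnn _) moveb) bx)
  (leq_add (leq_add (leqnn _) moves) sy)) _.
by rewrite addnACA addnA leqnn.
Qed.

(** The bound holds for each outcome [n] of the trades, since trades only remove traders; the
    survivors then stay with probability [1 - pQ]. *)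
Lemma traders_drift u :
  wsum (kernel u) (fun z => (traders z)%:R%:E) <=
  ((1 - pQ) * (traders u)%:R + (Lb + Ls))%:E.
Proof.
rewrite wsum_kernel ?esum_outcome; [|by move=> ?; rewrite lee_fin..].
have tw n : 0 <= (trades_weight u n)%:E by rewrite lee_fin trades_weight_ge0.
have aw k m : 0 <= (actions_weight k m)%:E by rewrite lee_fin actions_weight_ge0.
have P0 (L : R) k : 0 <= (poisson_pmf L k)%:E by rewrite lee_fin poisson_pmf_ge0.
have q0 : (0 <= 1 - pQ)%R by rewrite subr_ge0; case/andP: pQ01 => _ /ltW.
pose S (m : {ffun 'I_N -> seq action}) : R := (\sum_(i < N) (staying (m i))%:R)%R.
have S0 m : (0 <= S m)%R by rewrite sumr_ge0.
rewrite -[leRHS](@wsum_cst _ _ (fun n => (trades_weight u n)%:E))//; first last.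
- exact: trades_weight_sum1.
- rewrite lee_fin addr_ge0//; last by rewrite addr_ge0// ltW.
  by rewrite mulr_ge0.
apply: le_wsum => // n.
pose kb i := (u.1 i - n i)%N; pose ks i := (u.2 i - n i)%N.
apply: le_trans (_ : _ <=
  wsum (fun mb => (actions_weight kb mb)%:E) (fun mb =>
  wsum (fun ms => (actions_weight ks ms)%:E) (fun ms =>
  wsum (fun x => (poisson_pmf Lb x)%:E) (fun x =>
  wsum (fun y => (poisson_pmf Ls y)%:E) (fun y =>
    (S mb + S ms + x%:R)%:E + y%:R%:E))))) _.
  do 4 (apply: le_wsum => // ?); rewrite -EFinD lee_fin /S.
  by rewrite -!natr_sum -!natrD ler_nat traders_next.
have L0 : (0 <= Lb + Ls)%R by rewrite addr_ge0// ltW.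
have meanLs c : (0 <= c)%R -> wsum (fun y => (poisson_pmf Ls y)%:E)
    (fun y => c%:E + y%:R%:E) = (c + Ls)%:E.
  by move=> c0; rewrite wsum_shift// ?poisson_pmf_sum1// poisson_mean.
have meanLb c : (0 <= c)%R -> wsum (fun x => (poisson_pmf Lb x)%:E)
    (fun x => c%:E + x%:R%:E) = (c + Lb)%:E.
  by move=> c0; rewrite wsum_shift// ?poisson_pmf_sum1// poisson_mean.
have meanS k c : (0 <= c)%R -> wsum (fun m => (actions_weight k m)%:E)
    (fun m => c%:E + (S m)%:E) = (c + \sum_(i < N) (1 - pQ) * (k i)%:R)%:E.
  by move=> c0; rewrite wsum_shift// ?actions_weight_sum1// actions_weight_mean.
(* The sums over [y], [x] and [ms] are evaluated from the inside out, leaving the one over [mb]. *)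
rewrite (@eq_wsum _ _ _ _ (fun mb =>
    (Lb + Ls + \sum_(i < N) (1 - pQ) * (ks i)%:R)%:E + (S mb)%:E)); last first.
  move=> mb; rewrite (@eq_wsum _ _ _ _ (fun ms => (Lb + Ls + S mb)%:E + (S ms)%:E)).
    by rewrite meanS ?addr_ge0 ?(ltW Lb0) ?(ltW Ls0)// -EFinD; congr (_%:E); ring.
  move=> ms; rewrite (@eq_wsum _ _ _ _ (fun x => (Ls + S mb + S ms)%:E + x%:R%:E)).
    by rewrite meanLb ?addr_ge0 ?(ltW Ls0)// -EFinD; congr (_%:E); ring.
  by move=> x; rewrite meanLs ?addr_ge0 ?ler0n// -EFinD; congr (_%:E); ring.
rewrite meanS; last by rewrite addr_ge0// sumr_ge0// => i _; rewrite mulr_ge0.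
rewrite lee_fin -!mulr_sumr -addrA addrC lerD2r -mulrDr ler_wpM2l//.
rewrite -!natr_sum -natrD ler_nat /traders big_split /= addnC.
by apply: leq_add; apply: leq_sum => i _; exact: leq_subr.
Qed.

(** A single outcome of positive probability, without trades: [Quit] empties the book, [Stay] keeps
    it, [Move] shifts it. *)
Definition same_action (u : lob_state N) (a : action) (x y : nat) :
    lob_outcome N :=
  ([ffun=> 0%N], [ffun i => nseq (u.1 i) a], [ffun i => nseq (u.2 i) a], x, y).

Lemma kernel_ge_outcome u (w : lob_outcome N) :
  (out u w)%:E <= kernel u (lob_next w).
Proof.
apply: (le_esum_term (a := fun w => (out u w)%:E)) => // w'.
by rewrite lee_fin outcome_prob_ge0.
Qed.

Lemma same_action_prob u a x y : out u (same_action u a x y) =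
  (\prod_(i < N) ((1 - pT) ^+ minn (u.1 i) (u.2 i) *
     action_prob pQ pM a ^+ (u.1 i) * action_prob pQ pM a ^+ (u.2 i)) *
   poisson_pmf Lb x * poisson_pmf Ls y)%R.
Proof.
rewrite outcome_probE /trades_weight /actions_weight !big_split /=.
by congr (_ * _ * _ * _ * _)%R; apply: eq_bigr => i _;
  rewrite !ffunE ?subn0 ?actions_prob_nseq// /binomial_pmf expr0 mul1r subn0 bin0.
Qed.

Lemma poisson_pmf_gt0 (L : R) k : (0 < L)%R -> (0 < poisson_pmf L k)%R.
Proof.
by move=> L0; rewrite /poisson_pmf L0 !mulr_gt0 ?exprn_gt0 ?expR_gt0//.
Qed.

Lemma action_prob_gt0 a : (0 < action_prob pQ pM a)%R.
Proof.
case/andP: pQ01 => q0 _; case/andP: pM01 => m0 _.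
by case: a => //=; rewrite -addrA -opprD subr_gt0.
Qed.

Lemma kernel_same_action_gt0 u a x y : 0 < kernel u (lob_next (same_action u a x y)).
Proof.
apply: lt_le_trans (kernel_ge_outcome _ _); rewrite lte_fin same_action_prob.
have [_ pT1] := andP pT01.
rewrite !mulr_gt0 ?poisson_pmf_gt0// prodr_gt0// => i _.
by rewrite !mulr_gt0 ?exprn_gt0 ?action_prob_gt0 ?subr_gt0.
Qed.

Definition empty_book : lob_state N := ([ffun=> 0%N], [ffun=> 0%N]).

Lemma next_quit u : lob_next (same_action u Quit 0 0) = empty_book.
Proof.
congr pair; apply/ffunP => i; rewrite !ffunE count_nseq /= mul0n add0n.
  by rewrite big1 ?if_same// => j _; rewrite ffunE count_nseq.
by rewrite big1 ?if_same// => j _; rewrite ffunE count_nseq.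
Qed.

Lemma next_stay u : lob_next (same_action u Stay 0 0) = u.
Proof.
case: u => b s; congr pair; apply/ffunP => i; rewrite !ffunE count_nseq /= mul1n.
  by rewrite big1 ?if_same ?addn0// => j _; rewrite ffunE count_nseq.
by rewrite big1 ?if_same ?addn0// => j _; rewrite ffunE count_nseq.
Qed.

(** Nobody trades, all quit, nobody arrives. Each trader costs a factor [pQ], and the number of
    possible trades at a level is at most the number of traders there. *)
Lemma kernel_empty_ge n u : (traders u <= n)%N ->
  ((((1 - pT) * pQ) ^+ n * (poisson_pmf Lb 0 * poisson_pmf Ls 0))%R)%:E <=
  kernel u empty_book.
Proof.
move=> un; rewrite -(next_quit u); apply: le_trans (kernel_ge_outcome _ _).
rewrite lee_fin same_action_prob -mulrA ler_wpM2r//.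
  by rewrite mulr_ge0 ?poisson_pmf_ge0.
have [_ pT1] := andP pT01; have [q0 q1] := andP pQ01; have [t0 _] := andP pT01.
have t01 : (0 <= 1 - pT <= 1)%R by apply/andP; split; lra.
have r0 : (0 <= (1 - pT) * pQ)%R by rewrite mulr_ge0//; case/andP: t01.
apply: le_trans (_ : _ <= ((1 - pT) * pQ) ^+ traders u)%R _.
  rewrite ler_wiXn2l//; apply: mulr_ile1 => //; [by case/andP: t01..|exact: ltW].
rewrite /traders -prodrXr; apply: ler_prod => i _.
rewrite exprn_ge0//= exprMn -mulrA -exprD ler_wpM2r ?exprn_ge0//.
case/andP: t01 => ? ?; rewrite ler_wiXn2l//.
by rewrite geq_min leq_addr.
Qed.

(* Starting from [rewind v t], if everybody moves for [t] steps and the right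
   numbers of traders arrive, the book is [v]. *)
Definition rewind (v : lob_state N) (t : nat) : lob_state N :=
  ([ffun i : 'I_N => if insub (i + t)%N is Some j then v.1 j else 0%N],
   [ffun i : 'I_N => if (t <= i)%N then
      if insub (i - t)%N is Some j then v.2 j else 0%N else 0%N]).

Lemma rewind0 v : rewind v 0 = v.
Proof.
case: v => b s; congr pair; apply/ffunP => i; rewrite ffunE.
  by rewrite addn0 valK.
by rewrite leq0n subn0 valK.
Qed.

Lemma rewindN v : rewind v N = empty_book.
Proof.
congr pair; apply/ffunP => i; rewrite !ffunE.
  by rewrite insubF// ltnNge leq_addl.
by rewrite leqNgt ltn_ord.
Qed.

Lemma kernel_rewind_gt0 v t : 0 < kernel (rewind v t.+1) (rewind v t).
Proof.
(* With [t] steps to go, a buyer entering at the bottom ends at index [t] and a seller entering at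
   the top at [N.-1 - t]; outside the grid nobody is sent. *)
pose x : nat := if insub t is Some j then v.1 j else 0%N.
pose y : nat := if (t <= N.-1)%N then
  if insub (N.-1 - t)%N is Some j then v.2 j else 0%N else 0%N.
suff <- : lob_next (same_action (rewind v t.+1) Move x y) = rewind v t.
  exact: kernel_same_action_gt0.
congr pair; apply/ffunP => i; rewrite !ffunE count_nseq /= mul0n add0n.
- case: i => -[|i] iN /=.
    by rewrite big_pred0 ?add0n// => j; rewrite -lt0n.
  rewrite (big_pred1 (Ordinal (ltnW iN))) => [|j]; last by rewrite eqSS.
  by rewrite addn0 !ffunE count_nseq /= mul1n addnS addSn.
- have [iN|iN] := eqVneq i.+1 N.
    rewrite big_pred0 => [|j]; last first.
      by apply/negbTE; rewrite neq_ltn iN ltn_ord.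
    have Ni : N.-1 = i by rewrite -[in LHS]iN.
    by rewrite add0n /y Ni.
  have {}iN : (i.+1 < N)%N by rewrite ltn_neqAle iN ltn_ord.
  rewrite addn0 (big_pred1 (Ordinal iN)) => [|j]; last by [].
  by rewrite !ffunE count_nseq /= mul1n ltnS subSS.
Qed.

Lemma nstep_rewind_gt0 v t : 0 < nstep kernel t (rewind v t) v.
Proof.
elim: t => [|t IH]; first by rewrite rewind0 /= eqxx lte01.
apply: lt_le_trans (_ : 0 < kernel (rewind v t.+1) (rewind v t) *
    nstep kernel t (rewind v t) v) _.
  by rewrite mule_gt0// kernel_rewind_gt0.
apply: (le_esum_term (a := fun z => kernel _ z * nstep kernel t z v)) => // z.
by rewrite mule_ge0 ?kernel_ge0// nstep_ge0// => *; exact: kernel_ge0.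
Qed.

(** One step empties the book, and [N] steps of timed arrivals build any target. *)
Lemma kernel_irreducible : irreducible_chain kernel.
Proof.
move=> u v; exists N.+1.
apply: lt_le_trans (_ : 0 < kernel u empty_book * nstep kernel N empty_book v) _.
  rewrite mule_gt0//; last by rewrite -(rewindN v) nstep_rewind_gt0.
  by rewrite -(next_quit u) kernel_same_action_gt0.
apply: (le_esum_term (a := fun z => kernel _ z * nstep kernel N z v)) => // z.
by rewrite mule_ge0 ?kernel_ge0// nstep_ge0// => *; exact: kernel_ge0.
Qed.

(** Every book has a self-loop: no trade, no arrival, everybody stays. *)
Lemma kernel_aperiodic : aperiodic_chain kernel.
Proof.
move=> u k /(_ 1%N isT); rewrite dvdn1 => h; apply/eqP/h => /=.
rewrite (esum_pred1 (a := kernel u)) ?kernel_ge0// -[X in kernel u X]next_stay.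
exact: kernel_same_action_gt0.
Qed.

End LobChain.

Local Close Scope ereal_scope.

Theorem theorem1 (R : realType) (N : nat) (hN : (1 <= N)%N)
    (Lb Ls pT pQ pM : R)
    (hLb : 0 < Lb) (hLs : 0 < Ls)
    (hpT : 0 < pT < 1) (hpQ : 0 < pQ < 1) (hpM : 0 < pM < 1)
    (hpQM : pQ + pM < 1) :
  let p : lob_state N -> lob_state N -> \bar R :=
    lob_kernel Lb Ls pT pQ pM in
  [/\ irreducible_chain p, aperiodic_chain p, positive_recurrent_chain p &
    exists pi : lob_state N -> R,
      [/\ stationary_distribution p pi,
          (forall pi' : lob_state N -> R,
             stationary_distribution p pi' -> pi' = pi) &
          forall (d : measure_display) (Omega : measurableType d)
            (P : probability Omega R) (U : nat -> Omega -> lob_state N),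
            is_markov_chain p P U ->
            forall b s : {ffun 'I_N -> nat},
              P [set w | U t w = (b, s)] @[t --> \oo] --> (pi (b, s))%:E]].
Proof.
have [pT0 pT1] := andP hpT; have [pQ0 pQ1] := andP hpQ.
have p_ge0 := @kernel_ge0 R N Lb Ls pT pQ pM hpT hpQ hpM hpQM.
have p_sum1 := @kernel_sum1 R N Lb Ls pT pQ pM hLb hLs hpT hpQ hpM hpQM.
have irr := @kernel_irreducible R N Lb Ls pT pQ pM hLb hLs hpT hpQ hpM hpQM.
have q01 : 0 <= 1 - pQ < 1 by apply/andP; split; lra.
have L0 : 0 <= Lb + Ls by lra.
have a0 n : 0 < ((1 - pT) * pQ) ^+ n * (poisson_pmf Lb 0 * poisson_pmf Ls 0).
  by rewrite !mulr_gt0 ?exprn_gt0 ?poisson_pmf_gt0// mulr_gt0// subr_gt0.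
have [prec [pi [st uniq_st cvg_st]]] := ergodic_of_drift p_ge0 p_sum1 q01 L0 a0
  (traders_drift hLb hLs hpT hpQ hpM hpQM)
  (kernel_empty_ge Lb Ls hpT hpQ hpM hpQM) irr.
split => //; first exact: kernel_aperiodic.
exists pi; split => // d Omega P U markovU b s.
(* The law of [U 0] enters only as a weight on the starting states, which [cvg_st] allows to be any
   probability. *)
rewrite (_ : (fun t => _) = fun t => wsum (fun v => P [set w | U 0%N w = v])
    (fun v => nstep (lob_kernel Lb Ls pT pQ pM) t v (b, s))); last first.
  by apply/funext => t; exact: markov_marginal.
by apply: cvg_st => [v|]; [exact: measure_ge0|exact: initial_law_sum1 markovU].
Qed.
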